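(* Let $\psi_1,\psi_2\in\mathcal{P}$ satisfy $\min_{|z|=r}\Re\psi_i(z)=\psi_i(-r)$ for $0<r<1$, $i=1,2$, and let $0\le\gamma<1$. Let $g\in\mathcal{S}^*(\psi_1)$ and $h\in\mathcal{S}^*(\psi_2)$. Then the function $$F(z)=\frac{g(z)h(z)}{z}$$ is starlike of order $\gamma$ in the disk $|z|<r_\gamma$, where $r_\gamma$ is the least positive root of the equation $$\psi_1(-r)+\psi_2(-r)-1-\gamma=0.$$ The radius $r_\gamma$ is sharp.
   Context: $\mathbb{D}=\{z:|z|<1\}$. $\mathcal{A}$ is the class of analytic functions $f(z)=z+\sum_{k\ge2}a_kz^k$ in $\mathbb{D}$. $\mathcal{P}$ is the class of normalized Carathéodory functions: $p$ analytic in $\mathbb{D}$, $p(0)=1$, $\Re p(z)>0$. $\prec$ denotes subordination. $\mathcal{S}^*(\psi)=\{f\in\mathcal{A}:zf'(z)/f(z)\prec\psi(z)\}$. ''$F$ is starlike of order $\gamma$ in $|z|<\rho$'' means $\Re(zF'(z)/F(z))>\gamma$ for $|z|<\rho$. The root $r_\gamma$ is understood to lie in $(0,1)$. ''Sharp'' means that the radius cannot be replaced by a larger one valid for all such $g,h$. *)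

(* Defs.v *)
From Stdlib Require Import Reals.
From Coquelicot Require Import Coquelicot.
Open Scope C_scope.

Definition in_disk (z : C) : Prop := (Cmod z < 1)%R.

(* Complex differentiability: [ex_derive] is taken over the field C here. *)
Definition analytic_in_disk (f : C -> C) : Prop :=
  forall z : C, in_disk z -> ex_derive f z.

Definition class_A (f : C -> C) : Prop :=
  analytic_in_disk f /\
  exists a : nat -> C,
    a 0%nat = 0 /\ a 1%nat = 1 /\
    forall z : C, in_disk z -> is_pseries a z (f z).

Definition class_P (p : C -> C) : Prop :=
  analytic_in_disk p /\ p 0 = 1 /\
  forall z : C, in_disk z -> (0 < Re (p z))%R.

Definition subordinate (f psi : C -> C) : Prop :=
  exists w : C -> C,
    analytic_in_disk w /\ w 0 = 0 /\
    (forall z : C, in_disk z -> in_disk (w z)) /\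
    (forall z : C, in_disk z -> f z = psi (w z)).

(* The function z f'(z) / f(z), with its removable singularity at the origin
   (f(0) = 0, f'(0) = 1) filled by the limit value 1.  At a zero of f other
   than 0 the quotient is 0, because Coquelicot has / 0 = 0 in C.  All the
   conditions imposed on it below force its real part to be positive, so they
   exclude such zeros. *)
Definition starlike_quotient (f : C -> C) (z : C) : C :=
  if Ceq_dec z 0 then 1 else z * C_derive f z / f z.

Definition class_Sstar (psi f : C -> C) : Prop :=
  class_A f /\ subordinate (starlike_quotient f) psi.

Definition starlike_of_order_in (gamma rho : R) (F : C -> C) : Prop :=
  forall z : C, (Cmod z < rho)%R -> (gamma < Re (starlike_quotient F z))%R.

Definition is_min_on_circle (u : C -> R) (r m : R) : Prop :=
  (exists z : C, Cmod z = r /\ u z = m) /\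
  (forall z : C, Cmod z = r -> (m <= u z)%R).

(* The equation min Re psi = psi(-r) includes that psi(-r) is real. *)
Definition circle_min_at_neg (psi : C -> C) : Prop :=
  forall r : R, (0 < r < 1)%R ->
    exists m : R, is_min_on_circle (fun z => Re (psi z)) r m /\
                  RtoC m = psi (RtoC (- r)%R).

Definition radius_root (psi1 psi2 : C -> C) (gamma r : R) : Prop :=
  (0 < r < 1)%R /\
  psi1 (RtoC (- r)%R) + psi2 (RtoC (- r)%R) - 1 - RtoC gamma = 0.

Definition is_least_root (psi1 psi2 : C -> C) (gamma r : R) : Prop :=
  radius_root psi1 psi2 gamma r /\
  forall s : R, radius_root psi1 psi2 gamma s -> (r <= s)%R.

(* At z = 0 this is 0 (g(0) h(0) = 0 and / 0 = 0), the value of the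
   removable singularity. *)
Definition product_over_z (g h : C -> C) (z : C) : C := g z * h z / z.

(* Main.v *)
Require Import Defs.
From Stdlib Require Import Reals.
From Coquelicot Require Import Coquelicot.
From Stdlib Require Import Lra Lia Psatz Ranalysis5 IndefiniteDescription.

(** Away from the origin, logarithmic differentiation gives
    z F' / F = z g' / g + z h' / h - 1, and by subordination the first two terms
    are psi1 (w1 z) and psi2 (w2 z) with w1, w2 self-maps of the disk fixing 0.
    Schwarz's lemma gives |w_i z| <= |z|.  The real part of psi_i satisfies the
    minimum principle, so on |w| <= |z| it is at least its minimum on the circle
    of radius |z|, which is psi_i (-|z|).  Hence
    Re (z F' / F) >= psi1 (-|z|) + psi2 (-|z|) - 1, and by the intermediate value
    theorem this exceeds gamma as long as |z| is below the least root
    ([Re_quotient_lower_bound], [sum_gt_before_least_root]).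

    For sharpness, let g and h solve z g' / g = psi1 and z h' / h = psi2
    ([extremal_starlike_function]).  Then z F' / F takes the value gamma, which is
    not larger than gamma, at the point z = -r_gamma of every larger disk.

    Both halves rest on the classical theory of functions that are only assumed
    to be complex differentiable at each point, developed here from Goursat's
    theorem.  In the coordinate log z Goursat's theorem for rectangles says that
    the integral of f over |z| = r does not depend on r ([circle_int_annulus]).
    Since such integrals vary continuously with r, down to r = 0 and across a
    circle carrying an isolated exceptional point, they obey the mean value
    property ([circle_int_mean_value]); applied to z (f z - f a) / (z - a) it is
    Cauchy's formula ([cauchy_formula]).  From the formula come the maximum
    principle, with Schwarz's lemma and the minimum principle as special cases,
    and Taylor's theorem ([taylor_in_disk]).  The latter, together with termwise
    integration ([power_series_primitive]), yields the extremal functions as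
    z exp(P), with P a primitive of (psi - 1) / z. *)

Open Scope C_scope.

(** * Continuity of complex-valued maps *)

Notation continuous_C := (continuous (U := C_UniformSpace)).

Lemma continuous_C_pair {T : UniformSpace} (u v : T -> R) (x : T) :
  continuous u x -> continuous v x ->
  continuous_C (fun t => (u t, v t)) x.
Proof.
intros Hu Hv. apply filterlim_locally. intros eps.
exact (filter_and _ _ (proj1 (filterlim_locally _ _) Hu eps)
  (proj1 (filterlim_locally _ _) Hv eps)).
Qed.

Lemma continuous_Re {T : UniformSpace} (f : T -> C) (x : T) :
  continuous_C f x -> continuous (fun t => fst (f t)) x.
Proof.
intros Hf. apply filterlim_locally. intros eps.
generalize (proj1 (filterlim_locally _ _) Hf eps).
apply filter_imp. intros t H. apply H.
Qed.

Lemma continuous_Im {T : UniformSpace} (f : T -> C) (x : T) :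
  continuous_C f x -> continuous (fun t => snd (f t)) x.
Proof.
intros Hf. apply filterlim_locally. intros eps.
generalize (proj1 (filterlim_locally _ _) Hf eps).
apply filter_imp. intros t H. apply H.
Qed.

Lemma continuous_Cplus {T : UniformSpace} (f g : T -> C) (x : T) :
  continuous_C f x -> continuous_C g x ->
  continuous_C (fun t => f t + g t) x.
Proof.
intros Hf Hg. apply continuous_C_pair.
- apply (continuous_plus (fun t => fst (f t)) (fun t => fst (g t)));
    now apply continuous_Re.
- apply (continuous_plus (fun t => snd (f t)) (fun t => snd (g t)));
    now apply continuous_Im.
Qed.

Lemma continuous_Copp {T : UniformSpace} (f : T -> C) (x : T) :
  continuous_C f x ->
  continuous_C (fun t => - f t) x.
Proof.
intros Hf. apply continuous_C_pair.
- apply (continuous_opp (fun t => fst (f t))). now apply continuous_Re.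
- apply (continuous_opp (fun t => snd (f t))). now apply continuous_Im.
Qed.

Lemma continuous_Cminus {T : UniformSpace} (f g : T -> C) (x : T) :
  continuous_C f x -> continuous_C g x ->
  continuous_C (fun t => f t - g t) x.
Proof.
intros Hf Hg. apply continuous_Cplus; [ assumption | now apply continuous_Copp ].
Qed.

Lemma continuous_Cmult {T : UniformSpace} (f g : T -> C) (x : T) :
  continuous_C f x -> continuous_C g x ->
  continuous_C (fun t => f t * g t) x.
Proof.
intros Hf Hg.
generalize (continuous_Re f x Hf) (continuous_Im f x Hf)
  (continuous_Re g x Hg) (continuous_Im g x Hg); intros F1 F2 G1 G2.
apply continuous_C_pair.
- apply (continuous_minus (fun t => mult (fst (f t)) (fst (g t)))
    (fun t => mult (snd (f t)) (snd (g t))));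
    now apply (continuous_mult (K := R_AbsRing)).
- apply (continuous_plus (fun t => mult (fst (f t)) (snd (g t)))
    (fun t => mult (snd (f t)) (fst (g t))));
    now apply (continuous_mult (K := R_AbsRing)).
Qed.

Lemma continuous_Cinv {T : UniformSpace} (f : T -> C) (x : T) :
  continuous_C f x -> f x <> 0 ->
  continuous_C (fun t => / f t) x.
Proof.
intros Hf Hx.
generalize (continuous_Re f x Hf) (continuous_Im f x Hf); intros F1 F2.
assert (Hn : continuous (fun t => / (fst (f t) ^ 2 + snd (f t) ^ 2))%R x).
{ apply (continuous_comp (fun t => (fst (f t) ^ 2 + snd (f t) ^ 2)%R) Rinv).
  - apply (continuous_plus (fun t => (fst (f t) ^ 2)%R) (fun t => (snd (f t) ^ 2)%R)).
    + apply (continuous_ext (fun t => mult (fst (f t)) (fst (f t)))).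
      * intros t. unfold mult; simpl. ring.
      * now apply (continuous_mult (K := R_AbsRing)).
    + apply (continuous_ext (fun t => mult (snd (f t)) (snd (f t)))).
      * intros t. unfold mult; simpl. ring.
      * now apply (continuous_mult (K := R_AbsRing)).
  - apply continuous_Rinv. intros H. apply Hx.
    apply injective_projections; simpl; nra. }
apply continuous_C_pair.
- now apply (continuous_mult (K := R_AbsRing)).
- apply (continuous_mult (K := R_AbsRing) (fun t => opp (snd (f t)))).
  + now apply (continuous_opp (fun t => snd (f t))).
  + assumption.
Qed.

Lemma continuous_Cpow {T : UniformSpace} (f : T -> C) (n : nat) (x : T) :
  continuous_C f x ->
  continuous_C (fun t => f t ^ n) x.
Proof.
intros Hf. induction n as [ | n IH ].
- apply continuous_const.
- now apply (continuous_Cmult f (fun t => f t ^ n)).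
Qed.

Lemma continuous_C_iff (f : C -> C) (z : C) :
  continuous_C f z <->
  forall eps : R, (0 < eps)%R -> exists d : R, (0 < d)%R /\
    forall w : C, (Cmod (w - z) < d)%R -> (Cmod (f w - f z) < eps)%R.
Proof.
split.
- intros Hf eps He.
  assert (He' : (0 < eps / 2)%R) by lra.
  destruct (proj1 (filterlim_locally _ _) Hf (mkposreal _ He')) as [d Hd].
  exists d. split; [ apply d | ]. intros w Hw.
  assert (Hb : ball z d w).
  { apply C_NormedModule_mixin_compat1. exact Hw. }
  specialize (Hd w Hb). apply C_NormedModule_mixin_compat2 in Hd.
  change (Cmod (f w - f z) < sqrt 2 * (eps / 2))%R in Hd.
  assert (H3 := sqrt_pos 2). assert (H4 := sqrt_sqrt 2 ltac:(lra)). nra.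
- intros H. apply filterlim_locally. intros eps.
  destruct (H eps (cond_pos eps)) as [d [Hd Hw]].
  exists (mkposreal (d / 2) ltac:(lra)). intros w Hb.
  apply C_NormedModule_mixin_compat1. apply Hw.
  apply C_NormedModule_mixin_compat2 in Hb.
  change (Cmod (w - z) < sqrt 2 * (d / 2))%R in Hb.
  assert (H3 := sqrt_pos 2). assert (H4 := sqrt_sqrt 2 ltac:(lra)). nra.
Qed.

Lemma continuous_ext_near (f g : C -> C) (z : C) (d : R) :
  (0 < d)%R -> (forall w : C, (Cmod (w - z) < d)%R -> f w = g w) ->
  continuous_C f z ->
  continuous_C g z.
Proof.
intros Hd He Hf. apply continuous_C_iff. intros eps Heps.
destruct (proj1 (continuous_C_iff f z) Hf eps Heps) as [d' [Hd' H]].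
exists (Rmin d d'). split; [ now apply Rmin_glb_lt | ].
intros w Hw.
assert (H1 := Rmin_l d d'). assert (H2 := Rmin_r d d').
rewrite <- (He w), <- (He z).
- apply H. lra.
- replace (z - z) with (RtoC 0) by ring. now rewrite Cmod_0.
- lra.
Qed.

(** * Complex derivatives through continuous slopes *)

(** Caratheodory's form of differentiability: the difference quotient extends
    continuously by [l] at [z].  With the global equation for the slope, the
    rules of calculus reduce to algebra and continuity. *)
Definition has_Cderiv (f : C -> C) (z l : C) : Prop :=
  exists phi : C -> C,
    continuous_C phi z /\
    phi z = l /\ forall w : C, f w - f z = phi w * (w - z).

Lemma Cminus_neq_0 (w z : C) : w <> z -> w - z <> 0.
Proof.
intros H H0. apply H. replace w with (w - z + z) by ring. rewrite H0. ring.
Qed.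

Lemma has_Cderiv_iff (f : C -> C) (z l : C) :
  has_Cderiv f z l <->
  forall eps : R, (0 < eps)%R -> exists d : R, (0 < d)%R /\
    forall w : C, (Cmod (w - z) < d)%R ->
      (Cmod (f w - f z - l * (w - z)) <= eps * Cmod (w - z))%R.
Proof.
split.
- intros [phi [Hc [Hl Hphi]]] eps He.
  destruct (proj1 (continuous_C_iff phi z) Hc eps He) as [d [Hd H]].
  exists d. split; [ assumption | ]. intros w Hw.
  rewrite Hphi, <- Hl.
  replace (phi w * (w - z) - phi z * (w - z)) with ((phi w - phi z) * (w - z)) by ring.
  rewrite Cmod_mult. apply Rmult_le_compat_r; [ apply Cmod_ge_0 | ].
  now apply Rlt_le, H.
- intros H.
  exists (fun w => if Ceq_dec w z then l else (f w - f z) / (w - z)).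
  assert (Ez : (if Ceq_dec z z then l else (f z - f z) / (z - z)) = l).
  { destruct (Ceq_dec z z) as [_ | n]; [ reflexivity | now elim n ]. }
  split; [ | split ]; [ | exact Ez | ].
  + apply continuous_C_iff. intros eps He. cbv beta. rewrite Ez.
    destruct (H (eps / 2)%R ltac:(lra)) as [d [Hd Hw]].
    exists d. split; [ assumption | ]. intros w Hlt.
    destruct (Ceq_dec w z) as [ -> | n].
    * replace (l - l) with (RtoC 0) by ring. now rewrite Cmod_0.
    * specialize (Hw w Hlt). apply Cminus_neq_0 in n.
      replace ((f w - f z) / (w - z) - l) with ((f w - f z - l * (w - z)) / (w - z))
        by (field; assumption).
      rewrite Cmod_div by assumption.
      assert (Hp := proj1 (Cmod_gt_0 _) n).
      apply (Rle_lt_trans _ (eps / 2)); [ | lra ].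
      apply (Rmult_le_reg_r (Cmod (w - z))); [ assumption | ].
      unfold Rdiv. rewrite Rmult_assoc, Rinv_l by lra. lra.
  + intros w. destruct (Ceq_dec w z) as [ -> | n]; [ ring | ].
    field. now apply Cminus_neq_0.
Qed.

Lemma is_derive_has_Cderiv (f : C -> C) (z l : C) :
  is_derive (K := C_AbsRing) (V := C_NormedModule) f z l <-> has_Cderiv f z l.
Proof.
rewrite has_Cderiv_iff. split.
- intros [_ H] eps He.
  destruct (H z (fun P HP => HP) (mkposreal eps He)) as [d Hd].
  exists d. split; [ apply d | ]. intros w Hw.
  specialize (Hd w Hw).
  unfold minus, plus, opp, scal, norm in Hd; simpl in Hd.
  unfold mult in Hd; simpl in Hd.
  replace (f w - f z - l * (w - z)) with (f w + - f z + - ((w + - z) * l)) by ring.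
  exact Hd.
- intros H. split; [ apply is_linear_scal_l | ].
  intros x Hx. apply (is_filter_lim_locally_unique (V := AbsRing_NormedModule C_AbsRing)) in Hx. subst x.
  intros eps. destruct (H eps (cond_pos eps)) as [d [Hd Hw]].
  exists (mkposreal d Hd). intros w Hb.
  specialize (Hw w Hb).
  unfold minus, plus, opp, scal, norm; simpl. unfold mult; simpl.
  replace (f w - f z - l * (w - z)) with (f w + - f z + - ((w + - z) * l)) in Hw by ring.
  exact Hw.
Qed.

Lemma has_Cderiv_ext_near (f g : C -> C) (z l : C) (d : R) :
  (0 < d)%R -> (forall w : C, (Cmod (w - z) < d)%R -> f w = g w) ->
  has_Cderiv f z l -> has_Cderiv g z l.
Proof.
rewrite !has_Cderiv_iff. intros Hd He Hf eps Heps.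
destruct (Hf eps Heps) as [d' [Hd' H]].
exists (Rmin d d'). split; [ now apply Rmin_glb_lt | ].
intros w Hw.
assert (H1 := Rmin_l d d'). assert (H2 := Rmin_r d d').
rewrite <- (He w), <- (He z).
- apply H. lra.
- replace (z - z) with (RtoC 0) by ring. now rewrite Cmod_0.
- lra.
Qed.

(** The form in which derivatives are obtained from Taylor estimates, for the
    exponential and for power series. *)
Lemma has_Cderiv_quadratic (f : C -> C) (z l : C) (K d : R) :
  (0 < d)%R ->
  (forall w : C, (Cmod (w - z) < d)%R ->
     (Cmod (f w - f z - l * (w - z)) <= K * (Cmod (w - z) * Cmod (w - z)))%R) ->
  has_Cderiv f z l.
Proof.
intros Hd H. apply has_Cderiv_iff. intros eps He.
assert (HK : (0 < Rabs K + 1)%R) by (assert (h := Rabs_pos K); lra).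
assert (Hq : (0 < eps / (Rabs K + 1))%R) by now apply Rdiv_lt_0_compat.
exists (Rmin d (eps / (Rabs K + 1))). split; [ now apply Rmin_glb_lt | ].
intros w Hw.
assert (H1 := Rmin_l d (eps / (Rabs K + 1))). assert (H2 := Rmin_r d (eps / (Rabs K + 1))).
eapply Rle_trans; [ apply H; lra | ].
rewrite <- Rmult_assoc. apply Rmult_le_compat_r; [ apply Cmod_ge_0 | ].
assert (H3 : (Cmod (w - z) < eps / (Rabs K + 1))%R) by lra.
apply (Rmult_lt_compat_r (Rabs K + 1)) in H3; [ | assumption ].
unfold Rdiv in H3. rewrite Rmult_assoc, Rinv_l in H3 by lra.
assert (H4 := Rle_abs K). assert (H5 := Cmod_ge_0 (w - z)). nra.
Qed.

Lemma has_Cderiv_continuous (f : C -> C) (z l : C) :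
  has_Cderiv f z l -> continuous_C f z.
Proof.
intros [phi [Hc [_ Hphi]]].
apply (continuous_ext (fun w => f z + phi w * (w - z))).
- intros w. change (f z + phi w * (w - z) = f w). rewrite <- Hphi. ring.
- apply continuous_Cplus; [ apply continuous_const | ].
  apply continuous_Cmult; [ assumption | ].
  apply continuous_Cminus; [ apply continuous_id | apply continuous_const ].
Qed.

Lemma has_Cderiv_const (c z : C) : has_Cderiv (fun _ => c) z 0.
Proof.
exists (fun _ => 0). split; [ apply continuous_const | split; [ reflexivity | intros; ring ] ].
Qed.

Lemma has_Cderiv_id (z : C) : has_Cderiv (fun w => w) z 1.
Proof.
exists (fun _ => 1). split; [ apply continuous_const | split; [ reflexivity | intros; ring ] ].
Qed.

Lemma has_Cderiv_plus (f g : C -> C) (z l m : C) :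
  has_Cderiv f z l -> has_Cderiv g z m -> has_Cderiv (fun w => f w + g w) z (l + m).
Proof.
intros [phi [Hc [Hl Hphi]]] [chi [Kc [Kl Kchi]]].
exists (fun w => phi w + chi w). split; [ | split ].
- now apply continuous_Cplus.
- now rewrite Hl, Kl.
- intros w. replace (f w + g w - (f z + g z)) with ((f w - f z) + (g w - g z)) by ring.
  rewrite Hphi, Kchi. ring.
Qed.

Lemma has_Cderiv_mult (f g : C -> C) (z l m : C) :
  has_Cderiv f z l -> has_Cderiv g z m ->
  has_Cderiv (fun w => f w * g w) z (l * g z + f z * m).
Proof.
intros [phi [Hc [Hl Hphi]]] Hg.
assert (Gc := has_Cderiv_continuous _ _ _ Hg).
destruct Hg as [chi [Kc [Kl Kchi]]].
exists (fun w => phi w * g w + f z * chi w). split; [ | split ].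
- apply continuous_Cplus; apply continuous_Cmult; try assumption.
  apply continuous_const.
- now rewrite Hl, Kl.
- intros w. replace (f w * g w - f z * g z) with ((f w - f z) * g w + f z * (g w - g z)) by ring.
  rewrite Hphi, Kchi. ring.
Qed.

Lemma has_Cderiv_opp (f : C -> C) (z l : C) :
  has_Cderiv f z l -> has_Cderiv (fun w => - f w) z (- l).
Proof.
intros [phi [Hc [Hl Hphi]]]. exists (fun w => - phi w). split; [ | split ].
- now apply continuous_Copp.
- now rewrite Hl.
- intros w. replace (- f w - - f z) with (- (f w - f z)) by ring.
  rewrite Hphi. ring.
Qed.

Lemma has_Cderiv_minus (f g : C -> C) (z l m : C) :
  has_Cderiv f z l -> has_Cderiv g z m -> has_Cderiv (fun w => f w - g w) z (l - m).
Proof.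
intros Hf Hg. apply has_Cderiv_plus; [ assumption | now apply has_Cderiv_opp ].
Qed.

Lemma has_Cderiv_comp (f g : C -> C) (z l m : C) :
  has_Cderiv f (g z) l -> has_Cderiv g z m ->
  has_Cderiv (fun w => f (g w)) z (l * m).
Proof.
intros [phi [Hc [Hl Hphi]]] Hg.
assert (Gc := has_Cderiv_continuous _ _ _ Hg).
destruct Hg as [chi [Kc [Kl Kchi]]].
exists (fun w => phi (g w) * chi w). split; [ | split ].
- apply continuous_Cmult; [ | assumption ].
  now apply (continuous_comp g phi).
- now rewrite Hl, Kl.
- intros w. rewrite Hphi, Kchi. ring.
Qed.

Lemma has_Cderiv_Cinv (z : C) : z <> 0 -> has_Cderiv Cinv z (- / (z * z)).
Proof.
intros Hz.
(* The slope at the origin accounts for the convention / 0 = 0. *)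
exists (fun w => if Ceq_dec w 0 then / (z * z) else - / (w * z)).
assert (Hm : (0 < Cmod z)%R) by now apply Cmod_gt_0.
split; [ | split ].
- apply (continuous_ext_near (fun w => - / (w * z)) _ z (Cmod z)); [ assumption | | ].
  + intros w Hw. destruct (Ceq_dec w 0) as [ -> | n ]; [ exfalso | reflexivity ].
    replace (0 - z) with (- z) in Hw by ring. rewrite Cmod_opp in Hw. lra.
  + apply continuous_Copp, continuous_Cinv.
    * apply continuous_Cmult; [ apply continuous_id | apply continuous_const ].
    * now apply Cmult_neq_0.
- destruct (Ceq_dec z 0) as [ H | _ ]; [ contradiction | reflexivity ].
- intros w. destruct (Ceq_dec w 0) as [ -> | n ].
  + replace (/ 0) with (RtoC 0).
    * field. assumption.
    * apply injective_projections; simpl; unfold Rdiv; ring.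
  + field. now split.
Qed.

Lemma has_Cderiv_inv (f : C -> C) (z l : C) :
  has_Cderiv f z l -> f z <> 0 ->
  has_Cderiv (fun w => / f w) z (- / (f z * f z) * l).
Proof.
intros Hf Hz. apply (has_Cderiv_comp Cinv f); [ now apply has_Cderiv_Cinv | assumption ].
Qed.

Lemma has_Cderiv_pow (f : C -> C) (n : nat) (z l : C) :
  has_Cderiv f z l -> exists m : C, has_Cderiv (fun w => f w ^ n) z m.
Proof.
intros Hf. induction n as [ | n [m IH] ].
- exists 0. apply (has_Cderiv_const 1).
- eexists. apply (has_Cderiv_mult f (fun w => f w ^ n)); eassumption.
Qed.

(** * The complex exponential *)

Definition Cexp (z : C) : C := (exp (fst z) * cos (snd z), exp (fst z) * sin (snd z))%R.

Lemma Cexp_plus (z w : C) : Cexp (z + w) = Cexp z * Cexp w.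
Proof.
unfold Cexp. destruct z as [x y], w as [u v]. simpl.
rewrite exp_plus, cos_plus, sin_plus.
apply injective_projections; simpl; ring.
Qed.

Lemma Cexp_0 : Cexp 0 = 1.
Proof.
unfold Cexp. simpl. rewrite exp_0, cos_0, sin_0.
apply injective_projections; simpl; ring.
Qed.

Lemma Cmod_Cexp (z : C) : Cmod (Cexp z) = exp (fst z).
Proof.
unfold Cmod, Cexp. cbn [fst snd].
replace ((exp (fst z) * cos (snd z)) ^ 2 + (exp (fst z) * sin (snd z)) ^ 2)%R
  with (exp (fst z) * exp (fst z))%R.
- apply sqrt_square, Rlt_le, exp_pos.
- assert (H := sin2_cos2 (snd z)). unfold Rsqr in H. nra.
Qed.

Lemma Cexp_neq_0 (z : C) : Cexp z <> 0.
Proof.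
intros H. assert (Hm := Cmod_Cexp z). rewrite H, Cmod_0 in Hm.
assert (He := exp_pos (fst z)). lra.
Qed.

Lemma exp_minus_linear_bound (x : R) :
  (Rabs x <= 1 / 2)%R -> (Rabs (exp x - 1 - x) <= 2 * x ^ 2)%R.
Proof.
intros H. apply Rabs_le_between in H.
assert (H1 := exp_ineq1_le x). assert (H2 := exp_ineq1_le (- x)).
assert (H3 : (exp x * exp (- x) = 1)%R) by (rewrite <- exp_plus, Rplus_opp_r; apply exp_0).
assert (H4 := exp_pos x).
assert (H5 : (exp x * (1 - x) <= 1)%R) by nra.
apply Rabs_le. split; [ nra | ].
apply (Rmult_le_reg_r (1 - x)); [ lra | ]. nra.
Qed.

Lemma sin_sqr_le (h : R) : (sin h ^ 2 <= h ^ 2)%R.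
Proof.
assert (Hpos : forall t : R, (0 < t)%R -> (sin t ^ 2 <= t ^ 2)%R).
{ intros t Ht. assert (H1 := sin_lt_x t Ht). assert (H2 := SIN_bound t).
  destruct (Rle_dec t 1) as [ Hl | Hl ].
  - assert (H3 : (0 <= sin t)%R).
    { apply sin_ge_0; [ lra | ]. assert (h2 := PI2_1). lra. }
    nra.
  - nra. }
destruct (Rtotal_order 0 h) as [ Hh | [ <- | Hh ] ].
- now apply Hpos.
- rewrite sin_0. lra.
- assert (H := Hpos (- h)%R ltac:(lra)). rewrite sin_neg in H. nra.
Qed.

Lemma one_minus_cos_bound (y : R) : (0 <= 1 - cos y <= y ^ 2)%R.
Proof.
assert (H0 := COS_bound y). split; [ lra | ].
replace y with (2 * (y / 2))%R at 1 by field. rewrite cos_2a_sin.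
assert (H := sin_sqr_le (y / 2)). nra.
Qed.

Lemma sin_minus_id_bound (y : R) :
  (Rabs y <= 1)%R -> (Rabs (sin y - y) <= y ^ 2)%R.
Proof.
intros Hy.
destruct (MVT_gen (fun t => sin t - t)%R 0 y (fun t => cos t - 1)%R) as [c [Hc He]].
- intros x _. auto_derive; [ trivial | ring ].
- intros x _. apply continuity_pt_minus; [ apply continuity_sin | apply continuity_pt_id ].
- rewrite sin_0 in He. replace (sin y - y)%R with ((cos c - 1) * y)%R by lra.
  rewrite Rabs_mult.
  assert (H := one_minus_cos_bound c).
  rewrite Rabs_left1 by lra.
  assert (Hcy : (Rabs c <= Rabs y)%R).
  { unfold Rmin, Rmax in Hc. destruct (Rle_dec 0 y).
    - rewrite !Rabs_pos_eq by lra. lra.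
    - rewrite !Rabs_left1 by lra. lra. }
  rewrite <- (pow2_abs y). rewrite <- (pow2_abs c) in H.
  assert (H1 := Rabs_pos c). nra.
Qed.

Lemma Cmod_le_abs (z : C) : (Cmod z <= Rabs (fst z) + Rabs (snd z))%R.
Proof.
replace z with (RtoC (fst z) + Ci * RtoC (snd z)) at 1.
- eapply Rle_trans; [ apply Cmod_triangle | ].
  rewrite Cmod_mult, Cmod_Ci, !Cmod_R. lra.
- apply injective_projections; simpl; ring.
Qed.

Lemma has_Cderiv_Cexp_0 : has_Cderiv Cexp 0 1.
Proof.
apply (has_Cderiv_quadratic _ _ _ 9 (1 / 2)); [ lra | ].
intros w Hw. rewrite Cexp_0.
replace (w - 0) with w in * by ring. destruct w as [x y].
assert (Hm := Rmax_Cmod (x, y)). cbn [fst snd] in Hm.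
assert (Hx := Rmax_l (Rabs x) (Rabs y)). assert (Hy := Rmax_r (Rabs x) (Rabs y)).
set (m := Cmod (x, y)) in *.
assert (E := exp_minus_linear_bound x ltac:(lra)).
assert (K := one_minus_cos_bound y).
assert (S := sin_minus_id_bound y ltac:(lra)).
assert (Px := Rabs_pos x). assert (Py := Rabs_pos y).
rewrite <- (pow2_abs x) in E. rewrite <- (pow2_abs y) in K, S.
apply Rabs_le_between in E. apply Rabs_le_between in S.
assert (Ax := Rle_abs x). assert (Ax' := Rle_abs (- x)). rewrite Rabs_Ropp in Ax'.
assert (Ay := Rle_abs y). assert (Ay' := Rle_abs (- y)). rewrite Rabs_Ropp in Ay'.
set (a := Rabs x) in *. set (b := Rabs y) in *.
assert (Ex : (0 < exp x <= 2)%R) by (split; [ apply exp_pos | nra ]).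
eapply Rle_trans; [ apply Cmod_le_abs | ]. unfold Cexp. cbn -[Rabs pow exp cos sin].
apply (Rle_trans _ (4 * (m * m) + 5 * (m * m))%R); [ | lra ].
assert (Hm2 : (a ^ 2 <= m * m)%R) by nra. assert (Hm3 : (b ^ 2 <= m * m)%R) by nra.
assert (Hm4 : (a * b <= m * m)%R) by nra.
apply Rplus_le_compat; apply Rabs_le; split; try nra.
Qed.

Lemma has_Cderiv_Cexp (z : C) : has_Cderiv Cexp z (Cexp z).
Proof.
destruct has_Cderiv_Cexp_0 as [phi [Hc [Hl Hphi]]].
exists (fun w => Cexp z * phi (w - z)). split; [ | split ].
- apply continuous_Cmult; [ apply continuous_const | ].
  apply (continuous_comp (fun w => w - z) phi).
  + apply (continuous_Cminus (fun w => w)); [ apply continuous_id | apply continuous_const ].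
  + replace (z - z) with (RtoC 0) by ring. exact Hc.
- replace (z - z) with (RtoC 0) by ring. rewrite Hl. ring.
- intros w. specialize (Hphi (w - z)). rewrite Cexp_0 in Hphi.
  replace (Cexp w) with (Cexp z * Cexp (w - z)).
  + replace (Cexp z * Cexp (w - z) - Cexp z) with (Cexp z * (Cexp (w - z) - 1)) by ring.
    rewrite Hphi. ring.
  + rewrite <- Cexp_plus. f_equal. ring.
Qed.

(** * Integrals of complex-valued functions of a real variable *)

Definition Cint (f : R -> C) (a b : R) : C := RInt (V := C_R_CompleteNormedModule) f a b.

Definition continuous_on (f : R -> C) (a b : R) : Prop :=
  forall t : R, (a <= t <= b)%R -> continuous_C f t.

Lemma is_RInt_Cint (f : R -> C) (a b : R) :
  (a <= b)%R -> continuous_on f a b -> is_RInt (V := C_R_NormedModule) f a b (Cint f a b).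
Proof.
intros Hab H. apply (RInt_correct (V := C_R_CompleteNormedModule)).
apply (ex_RInt_continuous (V := C_R_CompleteNormedModule)). intros t Ht. apply H.
now rewrite Rmin_left, Rmax_right in Ht by assumption.
Qed.

Lemma is_RInt_Cint_unique (f : R -> C) (a b : R) (l : C) :
  is_RInt (V := C_R_NormedModule) f a b l -> Cint f a b = l.
Proof. apply (is_RInt_unique (V := C_R_CompleteNormedModule)). Qed.

Lemma Cint_ext (f g : R -> C) (a b : R) :
  (a <= b)%R -> (forall t : R, (a <= t <= b)%R -> f t = g t) -> Cint f a b = Cint g a b.
Proof.
intros Hab H. apply (RInt_ext (V := C_R_CompleteNormedModule)). intros t Ht. apply H.
rewrite Rmin_left, Rmax_right in Ht by assumption. lra.
Qed.

Lemma Cint_plus (f g : R -> C) (a b : R) :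
  (a <= b)%R -> continuous_on f a b -> continuous_on g a b ->
  Cint (fun t => f t + g t) a b = Cint f a b + Cint g a b.
Proof.
intros Hab Hf Hg. apply is_RInt_Cint_unique.
now apply (is_RInt_plus (V := C_R_NormedModule)); apply is_RInt_Cint.
Qed.

Lemma Cint_minus (f g : R -> C) (a b : R) :
  (a <= b)%R -> continuous_on f a b -> continuous_on g a b ->
  Cint (fun t => f t - g t) a b = Cint f a b - Cint g a b.
Proof.
intros Hab Hf Hg. apply is_RInt_Cint_unique.
now apply (is_RInt_minus (V := C_R_NormedModule)); apply is_RInt_Cint.
Qed.

Lemma Cint_Chasles (f : R -> C) (a b c : R) :
  (a <= b <= c)%R -> continuous_on f a c -> Cint f a b + Cint f b c = Cint f a c.
Proof.
intros [Hab Hbc] Hf. symmetry. apply is_RInt_Cint_unique.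
apply (is_RInt_Chasles (V := C_R_NormedModule) f a b c); apply is_RInt_Cint;
  try assumption; intros t Ht; apply Hf; lra.
Qed.

Lemma Cint_scal (k : C) (f : R -> C) (a b : R) :
  (a <= b)%R -> continuous_on f a b ->
  Cint (fun t => k * f t) a b = k * Cint f a b.
Proof.
intros Hab Hf. apply is_RInt_Cint_unique.
assert (H := is_RInt_Cint f a b Hab Hf).
apply (is_RInt_fct_extend_fst (U := R_NormedModule) (V := R_NormedModule)) in H as H1.
apply (is_RInt_fct_extend_snd (U := R_NormedModule) (V := R_NormedModule)) in H as H2.
apply (is_RInt_fct_extend_pair (U := R_NormedModule) (V := R_NormedModule)).
- exact (is_RInt_minus _ _ _ _ _ _ (is_RInt_scal _ _ _ (fst k) _ H1)
    (is_RInt_scal _ _ _ (snd k) _ H2)).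
- exact (is_RInt_plus _ _ _ _ _ _ (is_RInt_scal _ _ _ (fst k) _ H2)
    (is_RInt_scal _ _ _ (snd k) _ H1)).
Qed.

Lemma Cint_conj (f : R -> C) (a b : R) :
  (a <= b)%R -> continuous_on f a b ->
  Cint (fun t => Cconj (f t)) a b = Cconj (Cint f a b).
Proof.
intros Hab Hf. apply is_RInt_Cint_unique.
assert (H := is_RInt_Cint f a b Hab Hf).
apply (is_RInt_fct_extend_fst (U := R_NormedModule) (V := R_NormedModule)) in H as H1.
apply (is_RInt_fct_extend_snd (U := R_NormedModule) (V := R_NormedModule)) in H as H2.
apply (is_RInt_fct_extend_pair (U := R_NormedModule) (V := R_NormedModule)).
- exact H1.
- exact (is_RInt_opp _ _ _ _ H2).
Qed.

Lemma Cint_const (c : C) (a b : R) : Cint (fun _ => c) a b = RtoC (b - a) * c.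
Proof.
apply is_RInt_Cint_unique.
assert (H := is_RInt_const (V := C_R_NormedModule) a b c).
replace (RtoC (b - a) * c) with (scal (V := C_R_NormedModule) (b - a)%R c); [ exact H | ].
apply injective_projections; simpl; unfold scal; simpl; unfold mult; simpl; ring.
Qed.

Lemma Cmod_Cint_le (f : R -> C) (a b M : R) :
  (a <= b)%R -> continuous_on f a b ->
  (forall t : R, (a <= t <= b)%R -> (Cmod (f t) <= M)%R) ->
  (Cmod (Cint f a b) <= (b - a) * M)%R.
Proof.
intros Hab Hf HM. rewrite Cmod_norm.
apply (norm_RInt_le_const (V := C_R_NormedModule) f a b); [ assumption | | now apply is_RInt_Cint ].
intros t Ht. change (norm (V := C_R_NormedModule) (f t)) with (norm (V := prod_NormedModule R_AbsRing R_NormedModule R_NormedModule) (f t)).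
rewrite <- Cmod_norm. now apply HM.
Qed.

(** * Goursat's theorem for rectangles *)

(** The integral of f dz along the boundary of [x, x+a] x [y, y+b],
    counterclockwise. *)
Definition rect_int (f : C -> C) (x y a b : R) : C :=
  Cint (fun t => f (t, y)) x (x + a) - Cint (fun t => f (t, y + b)%R) x (x + a) +
  Ci * (Cint (fun t => f (x + a, t)%R) y (y + b) - Cint (fun t => f (x, t)) y (y + b)).

Definition continuous_on_rect (f : C -> C) (x y a b : R) : Prop :=
  forall u v : R, (x <= u <= x + a)%R -> (y <= v <= y + b)%R -> continuous_C f (u, v).

Lemma continuous_horizontal (f : C -> C) (t y : R) :
  continuous_C f (t, y) -> continuous_C (fun s : R => f (s, y)) t.
Proof.
intros H. apply (continuous_comp (fun s : R => ((s, y) : C)) f); [ | exact H ].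
apply continuous_C_pair; [ apply continuous_id | apply continuous_const ].
Qed.

Lemma continuous_vertical (f : C -> C) (x t : R) :
  continuous_C f (x, t) -> continuous_C (fun s : R => f (x, s)) t.
Proof.
intros H. apply (continuous_comp (fun s : R => ((x, s) : C)) f); [ | exact H ].
apply continuous_C_pair; [ apply continuous_const | apply continuous_id ].
Qed.

Ltac on_side :=
  let t := fresh "t" in let Ht := fresh "Ht" in
  intros t Ht;
  first [ apply continuous_horizontal | apply continuous_vertical ];
  match goal with H : continuous_on_rect _ _ _ _ _ |- _ => apply H; lra end.

Lemma rect_int_quarters (f : C -> C) (x y a b : R) :
  (0 <= a)%R -> (0 <= b)%R -> continuous_on_rect f x y a b ->
  rect_int f x y a b =
  rect_int f x y (a / 2) (b / 2) + rect_int f (x + a / 2) y (a / 2) (b / 2) +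
  (rect_int f x (y + b / 2) (a / 2) (b / 2) +
   rect_int f (x + a / 2) (y + b / 2) (a / 2) (b / 2)).
Proof.
intros Ha Hb Hc. unfold rect_int.
replace (x + a / 2 + a / 2)%R with (x + a)%R by field.
replace (y + b / 2 + b / 2)%R with (y + b)%R by field.
rewrite <- (Cint_Chasles (fun t => f (t, y)) x (x + a / 2) (x + a)) by (lra || on_side).
rewrite <- (Cint_Chasles (fun t => f (t, y + b)%R) x (x + a / 2) (x + a)) by (lra || on_side).
rewrite <- (Cint_Chasles (fun t => f (x, t)) y (y + b / 2) (y + b)) by (lra || on_side).
rewrite <- (Cint_Chasles (fun t => f (x + a, t)%R) y (y + b / 2) (y + b)) by (lra || on_side).
ring.
Qed.

Lemma rect_int_plus (f g : C -> C) (x y a b : R) :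
  (0 <= a)%R -> (0 <= b)%R ->
  continuous_on_rect f x y a b -> continuous_on_rect g x y a b ->
  rect_int (fun w => f w + g w) x y a b = rect_int f x y a b + rect_int g x y a b.
Proof.
intros Ha Hb Hf Hg. unfold rect_int.
rewrite !Cint_plus by
  (lra || (intros t Ht; first [ apply continuous_horizontal | apply continuous_vertical ];
           first [ apply Hf; lra | apply Hg; lra ])).
ring.
Qed.

Lemma rect_int_ext (f g : C -> C) (x y a b : R) :
  (0 <= a)%R -> (0 <= b)%R -> (forall w : C, f w = g w) ->
  rect_int f x y a b = rect_int g x y a b.
Proof.
intros Ha Hb H. unfold rect_int.
rewrite (Cint_ext (fun t => f (t, y)) (fun t => g (t, y))) by (lra || auto).
rewrite (Cint_ext (fun t => f (t, y + b)%R) (fun t => g (t, y + b)%R)) by (lra || auto).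
rewrite (Cint_ext (fun t => f (x, t)) (fun t => g (x, t))) by (lra || auto).
now rewrite (Cint_ext (fun t => f (x + a, t)%R) (fun t => g (x + a, t)%R)) by (lra || auto).
Qed.

Lemma Cint_horizontal_id (a b y : R) :
  Cint (fun t => (t, y)) a b = (((b * b - a * a) / 2)%R, ((b - a) * y)%R).
Proof.
apply is_RInt_Cint_unique.
apply (is_RInt_fct_extend_pair (U := R_NormedModule) (V := R_NormedModule)); simpl.
- replace ((b * b - a * a) / 2)%R with (minus (b * b / 2) (a * a / 2))%R
    by (unfold minus, plus, opp; simpl; field).
  apply (is_RInt_derive (V := R_CompleteNormedModule) (fun t => t * t / 2)%R).
  + intros t _. auto_derive; [ trivial | field ].
  + intros t _. apply continuous_id.
- apply (is_RInt_const (V := R_NormedModule)).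
Qed.

Lemma Cint_vertical_id (a b x : R) :
  Cint (fun t => (x, t)) a b = (((b - a) * x)%R, ((b * b - a * a) / 2)%R).
Proof.
apply is_RInt_Cint_unique.
apply (is_RInt_fct_extend_pair (U := R_NormedModule) (V := R_NormedModule)); simpl.
- apply (is_RInt_const (V := R_NormedModule)).
- replace ((b * b - a * a) / 2)%R with (minus (b * b / 2) (a * a / 2))%R
    by (unfold minus, plus, opp; simpl; field).
  apply (is_RInt_derive (V := R_CompleteNormedModule) (fun t => t * t / 2)%R).
  + intros t _. auto_derive; [ trivial | field ].
  + intros t _. apply continuous_id.
Qed.

Lemma rect_int_affine (c l : C) (x y a b : R) :
  (0 <= a)%R -> (0 <= b)%R -> rect_int (fun w => c + l * w) x y a b = 0.
Proof.
intros Ha Hb.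
assert (Hh : forall u v s : R, continuous_on (fun t => (t, s)) u v).
{ intros u v s t _. apply continuous_C_pair; [ apply continuous_id | apply continuous_const ]. }
assert (Hv : forall u v s : R, continuous_on (fun t => (s, t)) u v).
{ intros u v s t _. apply continuous_C_pair; [ apply continuous_const | apply continuous_id ]. }
assert (Hk : forall u v : R, continuous_on (fun _ => c) u v).
{ intros u v t _. apply continuous_const. }
assert (Hm : forall (f : R -> C) (u v : R), continuous_on f u v -> continuous_on (fun t => l * f t) u v).
{ intros f u v Hf t Ht. apply continuous_Cmult; [ apply continuous_const | now apply Hf ]. }
unfold rect_int.
rewrite !(Cint_plus (fun _ => c)) by (lra || auto).
rewrite !(Cint_scal l) by (lra || auto).
rewrite !Cint_const, !Cint_horizontal_id, !Cint_vertical_id.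
apply injective_projections; simpl; field.
Qed.

Lemma Cmod_rect_int_le (f : C -> C) (x y a b M : R) :
  (0 <= a)%R -> (0 <= b)%R -> continuous_on_rect f x y a b ->
  (forall u v : R, (x <= u <= x + a)%R -> (y <= v <= y + b)%R -> (Cmod (f (u, v)) <= M)%R) ->
  (Cmod (rect_int f x y a b) <= 2 * (a + b) * M)%R.
Proof.
intros Ha Hb Hc HM. unfold rect_int.
assert (B1 : (Cmod (Cint (fun t => f (t, y)) x (x + a)) <= (x + a - x) * M)%R).
{ apply Cmod_Cint_le; [ lra | on_side | intros; apply HM; lra ]. }
assert (B2 : (Cmod (Cint (fun t => f (t, (y + b)%R)) x (x + a)) <= (x + a - x) * M)%R).
{ apply Cmod_Cint_le; [ lra | on_side | intros; apply HM; lra ]. }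
assert (B3 : (Cmod (Cint (fun t => f ((x + a)%R, t)) y (y + b)) <= (y + b - y) * M)%R).
{ apply Cmod_Cint_le; [ lra | on_side | intros; apply HM; lra ]. }
assert (B4 : (Cmod (Cint (fun t => f (x, t)) y (y + b)) <= (y + b - y) * M)%R).
{ apply Cmod_Cint_le; [ lra | on_side | intros; apply HM; lra ]. }
eapply Rle_trans; [ apply Cmod_triangle | ].
rewrite Cmod_mult, Cmod_Ci.
unfold Cminus.
assert (T1 := Cmod_triangle (Cint (fun t => f (t, y)) x (x + a)) (- Cint (fun t => f (t, (y + b)%R)) x (x + a))).
assert (T2 := Cmod_triangle (Cint (fun t => f ((x + a)%R, t)) y (y + b)) (- Cint (fun t => f (x, t)) y (y + b))).
rewrite Cmod_opp in T1, T2. lra.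
Qed.

(** The four quarters cannot all be light, by [rect_int_quarters]; the last one
    serves as default, which makes the choice a plain function to iterate. *)
Definition heavy_quarter (f : C -> C) (x y a b : R) : R * R :=
  let heavy u v := Rle_dec (Cmod (rect_int f x y a b)) (4 * Cmod (rect_int f u v (a / 2) (b / 2))) in
  if heavy x y then (x, y)
  else if heavy (x + a / 2)%R y then ((x + a / 2)%R, y)
  else if heavy x (y + b / 2)%R then (x, (y + b / 2)%R)
  else ((x + a / 2)%R, (y + b / 2)%R).

Lemma heavy_quarter_heavy (f : C -> C) (x y a b : R) :
  (0 <= a)%R -> (0 <= b)%R -> continuous_on_rect f x y a b ->
  let p := heavy_quarter f x y a b in
  (Cmod (rect_int f x y a b) <= 4 * Cmod (rect_int f (fst p) (snd p) (a / 2) (b / 2)))%R.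
Proof.
intros Ha Hb Hc. unfold heavy_quarter.
do 3 (destruct Rle_dec as [ ? | ?%Rnot_le_lt ]; [ assumption | ]).
cbn [fst snd].
assert (E := f_equal Cmod (rect_int_quarters f x y a b Ha Hb Hc)).
assert (T := Cmod_triangle
  (rect_int f x y (a / 2) (b / 2) + rect_int f (x + a / 2) y (a / 2) (b / 2))
  (rect_int f x (y + b / 2) (a / 2) (b / 2) +
   rect_int f (x + a / 2) (y + b / 2) (a / 2) (b / 2))).
assert (T1 := Cmod_triangle (rect_int f x y (a / 2) (b / 2)) (rect_int f (x + a / 2) y (a / 2) (b / 2))).
assert (T2 := Cmod_triangle (rect_int f x (y + b / 2) (a / 2) (b / 2))
   (rect_int f (x + a / 2) (y + b / 2) (a / 2) (b / 2))).
lra.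
Qed.

Lemma heavy_quarter_corner (f : C -> C) (x y a b : R) :
  let p := heavy_quarter f x y a b in
  (fst p = x \/ fst p = x + a / 2)%R /\ (snd p = y \/ snd p = y + b / 2)%R.
Proof.
unfold heavy_quarter. repeat destruct Rle_dec; simpl; auto.
Qed.

Fixpoint heavy_corner (f : C -> C) (x y a b : R) (n : nat) : R * R :=
  match n with
  | O => (x, y)
  | S m => let p := heavy_corner f x y a b m in
           heavy_quarter f (fst p) (snd p) (a * (1 / 2) ^ m) (b * (1 / 2) ^ m)
  end.

Lemma nested_halves (u : nat -> R) (a : R) :
  (0 <= a)%R ->
  (forall n : nat, u (S n) = u n \/ u (S n) = u n + a * (1 / 2) ^ n / 2)%R ->
  exists X : R, forall n : nat, (u n <= X <= u n + a * (1 / 2) ^ n)%R.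
Proof.
intros Ha Hu.
assert (Hp : forall n : nat, (0 <= a * (1 / 2) ^ n)%R).
{ intros n. apply Rmult_le_pos; [ assumption | apply pow_le; lra ]. }
assert (Hs : forall n : nat, (a * (1 / 2) ^ S n = a * (1 / 2) ^ n / 2)%R).
{ intros n. simpl. field. }
assert (Hstep : forall n : nat,
  (u n <= u (S n))%R /\ (u (S n) + a * (1 / 2) ^ S n <= u n + a * (1 / 2) ^ n)%R).
{ intros n. rewrite Hs. specialize (Hp n). destruct (Hu n) as [ -> | -> ]; lra. }
assert (Hmono : forall n k : nat,
  (u n <= u (n + k)%nat)%R /\
  (u (n + k)%nat + a * (1 / 2) ^ (n + k) <= u n + a * (1 / 2) ^ n)%R).
{ intros n k. induction k as [ | k IH ].
  - rewrite Nat.add_0_r. lra.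
  - rewrite Nat.add_succ_r. specialize (Hstep (n + k)%nat). lra. }
assert (Hcross : forall m n : nat, (u m <= u n + a * (1 / 2) ^ n)%R).
{ intros m n. destruct (Nat.le_ge_cases m n) as [ H | H ].
  - destruct (Hmono m (n - m)%nat) as [H1 _].
    replace (m + (n - m))%nat with n in H1 by lia. specialize (Hp n). lra.
  - destruct (Hmono n (m - n)%nat) as [_ H1].
    replace (n + (m - n))%nat with m in H1 by lia. specialize (Hp m). lra. }
destruct (completeness (fun r => exists m : nat, r = u m)) as [X [HX1 HX2]].
- exists (u O + a * (1 / 2) ^ 0)%R. intros r [m ->]. apply Hcross.
- exists (u O). now exists O.
- exists X. intros n. split.
  + apply HX1. now exists n.
  + apply HX2. intros r [m ->]. apply Hcross.
Qed.

(** Goursat's bisection: a boundary integral of size m > 0 would survive as at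
    least m / 4^n on some rectangle of the n-th subdivision.  These rectangles
    shrink to a point, where f is affine up to o(2^-n); the affine part has
    integral zero, so the integral is o(4^-n). *)
Lemma goursat_rectangle (f : C -> C) (x y a b : R) :
  (0 <= a)%R -> (0 <= b)%R ->
  (forall u v : R, (x <= u <= x + a)%R -> (y <= v <= y + b)%R ->
     exists l : C, has_Cderiv f (u, v) l) ->
  rect_int f x y a b = 0.
Proof.
intros Ha Hb Hf.
assert (Hc : continuous_on_rect f x y a b).
{ intros u v Hu Hv. destruct (Hf u v Hu Hv) as [l Hl]. now apply has_Cderiv_continuous in Hl. }
apply Cmod_eq_0. apply Rle_antisym; [ | apply Cmod_ge_0 ].
apply Rnot_lt_le. intros Hm.
set (m := Cmod (rect_int f x y a b)) in *.
set (p := heavy_corner f x y a b).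
assert (Hcor : forall n : nat,
  (fst (p (S n)) = fst (p n) \/ fst (p (S n)) = fst (p n) + a * (1 / 2) ^ n / 2)%R /\
  (snd (p (S n)) = snd (p n) \/ snd (p (S n)) = snd (p n) + b * (1 / 2) ^ n / 2)%R).
{ intros n. apply (heavy_quarter_corner f). }
destruct (nested_halves (fun n => fst (p n)) a Ha (fun n => proj1 (Hcor n))) as [X HX].
destruct (nested_halves (fun n => snd (p n)) b Hb (fun n => proj2 (Hcor n))) as [Y HY].
cbv beta in HX, HY.
assert (Hhalf : forall n : nat, (0 < (1 / 2) ^ n)%R) by (intros n; apply pow_lt; lra).
assert (Hin : forall n : nat,
  (x <= fst (p n) /\ fst (p n) + a * (1 / 2) ^ n <= x + a)%R /\
  (y <= snd (p n) /\ snd (p n) + b * (1 / 2) ^ n <= y + b)%R).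
{ induction n as [ | n [[I1 I2] [I3 I4]] ].
  - simpl. lra.
  - assert (Ea : (a * (1 / 2) ^ S n = a * (1 / 2) ^ n / 2)%R) by (simpl; field).
    assert (Eb : (b * (1 / 2) ^ S n = b * (1 / 2) ^ n / 2)%R) by (simpl; field).
    assert (Pa := Rmult_le_pos a _ Ha (Rlt_le _ _ (Hhalf n))).
    assert (Pb := Rmult_le_pos b _ Hb (Rlt_le _ _ (Hhalf n))).
    rewrite Ea, Eb.
    destruct (Hcor n) as [[ -> | -> ] [ -> | -> ]]; lra. }
assert (Hcn : forall n : nat, continuous_on_rect f (fst (p n)) (snd (p n)) (a * (1 / 2) ^ n) (b * (1 / 2) ^ n)).
{ intros n u v Hu Hv. destruct (Hin n) as [[I1 I2] [I3 I4]]. apply Hc; lra. }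
assert (Hheavy : forall n : nat,
  (m * ((1 / 2) ^ n * (1 / 2) ^ n) <= Cmod (rect_int f (fst (p n)) (snd (p n)) (a * (1 / 2) ^ n) (b * (1 / 2) ^ n)))%R).
{ induction n as [ | n IH ].
  - simpl. rewrite !Rmult_1_r. apply Rle_refl.
  - assert (H := heavy_quarter_heavy f _ _ _ _
      (Rmult_le_pos a _ Ha (Rlt_le _ _ (Hhalf n)))
      (Rmult_le_pos b _ Hb (Rlt_le _ _ (Hhalf n))) (Hcn n)).
    cbv zeta in H. change (heavy_quarter f (fst (p n)) (snd (p n)) (a * (1 / 2) ^ n) (b * (1 / 2) ^ n)) with (p (S n)) in H.
    replace (a * (1 / 2) ^ S n)%R with (a * (1 / 2) ^ n / 2)%R by (simpl; field).
    replace (b * (1 / 2) ^ S n)%R with (b * (1 / 2) ^ n / 2)%R by (simpl; field).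
    replace (m * ((1 / 2) ^ S n * (1 / 2) ^ S n))%R with (m * ((1 / 2) ^ n * (1 / 2) ^ n) / 4)%R by (simpl; field).
    lra. }
assert (HXx : (x <= X <= x + a)%R) by (specialize (HX O); simpl in HX; lra).
assert (HYy : (y <= Y <= y + b)%R) by (specialize (HY O); simpl in HY; lra).
destruct (Hf X Y HXx HYy) as [l Hl].
set (s := (a + b)%R). assert (Hs : (0 <= s)%R) by (unfold s; lra).
(* An error eps |w - (X, Y)| bounds the n-th integral by 2 eps s^2 / 4^n; this
   eps makes the bound smaller than m / 4^n. *)
set (eps := (m / (4 * (s * s + 1)))%R).
assert (Heps : (0 < eps)%R) by (apply Rdiv_lt_0_compat; [ assumption | nra ]).
destruct (proj1 (has_Cderiv_iff f (X, Y) l) Hl eps Heps) as [d [Hd Hnear]].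
destruct (pow_lt_1_zero (1 / 2) ltac:(rewrite Rabs_pos_eq; lra) (d / (s + 1)) ltac:(apply Rdiv_lt_0_compat; lra)) as [N HN].
specialize (HN N (Nat.le_refl N)). rewrite Rabs_pos_eq in HN by (apply Rlt_le, Hhalf).
specialize (Hheavy N). specialize (Hcn N). specialize (HX N). specialize (HY N). specialize (Hhalf N).
set (h := ((1 / 2) ^ N)%R) in *.
assert (Hsd : (s * h < d)%R).
{ apply (Rmult_lt_compat_r (s + 1)) in HN; [ | lra ].
  unfold Rdiv in HN. rewrite Rmult_assoc, Rinv_l in HN by lra. nra. }
assert (Hah : (0 <= a * h)%R) by nra. assert (Hbh : (0 <= b * h)%R) by nra.
set (g := fun w : C => f w - f (X, Y) - l * (w - (X, Y))).
assert (Hcg : continuous_on_rect g (fst (p N)) (snd (p N)) (a * h) (b * h)).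
{ intros u v Hu Hv. unfold g.
  apply continuous_Cminus; [ apply continuous_Cminus; [ now apply Hcn | apply continuous_const ] | ].
  apply continuous_Cmult; [ apply continuous_const | ].
  apply continuous_Cminus; [ apply continuous_id | apply continuous_const ]. }
assert (Hsplit : rect_int f (fst (p N)) (snd (p N)) (a * h) (b * h) =
                 rect_int g (fst (p N)) (snd (p N)) (a * h) (b * h)).
{ rewrite (rect_int_ext f (fun w => g w + ((f (X, Y) - l * (X, Y)) + l * w))); try assumption.
  - rewrite rect_int_plus; try assumption.
    + rewrite rect_int_affine by assumption. ring.
    + intros u v _ _. apply continuous_Cplus; [ apply continuous_const | ].
      apply continuous_Cmult; [ apply continuous_const | apply continuous_id ].
  - intros w. unfold g. ring. }
assert (Hsmall : (Cmod (rect_int g (fst (p N)) (snd (p N)) (a * h) (b * h)) <= 2 * (a * h + b * h) * (eps * (s * h)))%R).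
{ apply Cmod_rect_int_le; try assumption.
  intros u v Hu Hv.
  assert (Hdist : (Cmod ((u, v) - (X, Y)) <= s * h)%R).
  { eapply Rle_trans; [ apply Cmod_le_abs | ]. simpl.
    replace (s * h)%R with (a * h + b * h)%R by (unfold s; ring).
    apply Rplus_le_compat; apply Rabs_le; lra. }
  unfold g. eapply Rle_trans; [ apply Hnear; lra | ].
  apply Rmult_le_compat_l; lra. }
rewrite Hsplit in Hheavy.
assert (Hfin : (m * (h * h) <= 2 * eps * (s * s) * (h * h))%R).
{ eapply Rle_trans; [ eapply Rle_trans; [ exact Hheavy | exact Hsmall ] | ]. unfold s. nra. }
apply Rmult_le_reg_r in Hfin; [ | nra ].
assert (Heq : (eps * (4 * (s * s + 1)) = m)%R) by (unfold eps; field; nra).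
nra.
Qed.

(** * Integrals over circles *)

Definition circle_point (r t : R) : C := (r * cos t, r * sin t)%R.

Definition circle_int (f : C -> C) (r : R) : C :=
  Cint (fun t => f (circle_point r t)) 0 (2 * PI).

Lemma two_PI_pos : (0 < 2 * PI)%R.
Proof. assert (H := PI_RGT_0). lra. Qed.

Lemma Cmod_circle_point (r t : R) : (0 <= r)%R -> Cmod (circle_point r t) = r.
Proof.
intros Hr. unfold Cmod, circle_point. cbn [fst snd].
replace ((r * cos t) ^ 2 + (r * sin t) ^ 2)%R with (r * r)%R.
- now apply sqrt_square.
- assert (H := sin2_cos2 t). unfold Rsqr in H. nra.
Qed.

Lemma continuous_circle_point (r t : R) : continuous_C (circle_point r) t.
Proof.
apply continuous_C_pair; apply (continuous_scal_r (K := R_AbsRing) (V := R_NormedModule) r).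
- apply continuous_cos.
- apply continuous_sin.
Qed.

Lemma continuous_on_circle (f : C -> C) (r a b : R) :
  (0 <= r)%R -> (forall z : C, Cmod z = r -> continuous_C f z) ->
  continuous_on (fun t => f (circle_point r t)) a b.
Proof.
intros Hr Hf t _. apply (continuous_comp (circle_point r) f).
- apply continuous_circle_point.
- now apply Hf, Cmod_circle_point.
Qed.

Lemma Cexp_circle_point (r t : R) : (0 < r)%R -> Cexp (ln r, t) = circle_point r t.
Proof. intros Hr. unfold Cexp, circle_point. cbn [fst snd]. now rewrite exp_ln. Qed.

Lemma exp_le_exp (x y : R) : (x <= y)%R -> (exp x <= exp y)%R.
Proof. intros [ H | -> ]; [ now apply Rlt_le, exp_increasing | apply Rle_refl ]. Qed.

Lemma circle_int_bound (f : C -> C) (r M : R) :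
  (0 <= r)%R -> (forall z : C, Cmod z = r -> continuous_C f z) ->
  (forall z : C, Cmod z = r -> (Cmod (f z) <= M)%R) ->
  (Cmod (circle_int f r) <= 2 * PI * M)%R.
Proof.
intros Hr Hc HM. assert (H := two_PI_pos).
eapply Rle_trans; [ apply (Cmod_Cint_le _ _ _ M) | lra ].
- lra.
- now apply continuous_on_circle.
- intros t _. now apply HM, Cmod_circle_point.
Qed.

Lemma circle_int_ext (f g : C -> C) (r : R) :
  (0 <= r)%R -> (forall z : C, Cmod z = r -> f z = g z) -> circle_int f r = circle_int g r.
Proof.
intros Hr H. assert (Hp := two_PI_pos).
apply Cint_ext; [ lra | intros t _; now apply H, Cmod_circle_point ].
Qed.

Lemma circle_int_minus (f g : C -> C) (r : R) :
  (0 <= r)%R -> (forall z : C, Cmod z = r -> continuous_C f z) ->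
  (forall z : C, Cmod z = r -> continuous_C g z) ->
  circle_int (fun z => f z - g z) r = circle_int f r - circle_int g r.
Proof.
intros Hr Hf Hg. assert (Hp := two_PI_pos).
apply (Cint_minus (fun t => f (circle_point r t)) (fun t => g (circle_point r t)));
  [ lra | now apply continuous_on_circle | now apply continuous_on_circle ].
Qed.

Lemma circle_int_scal (k : C) (f : C -> C) (r : R) :
  (0 <= r)%R -> (forall z : C, Cmod z = r -> continuous_C f z) ->
  circle_int (fun z => k * f z) r = k * circle_int f r.
Proof.
intros Hr Hf. assert (Hp := two_PI_pos).
apply (Cint_scal k (fun t => f (circle_point r t)));
  [ lra | now apply continuous_on_circle ].
Qed.

(** In the variable log z the annulus becomes a rectangle, and the two
    horizontal sides cancel because exp has period 2 pi i. *)
Lemma circle_int_annulus (f : C -> C) (r1 r2 : R) :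
  (0 < r1 <= r2)%R ->
  (forall z : C, (r1 <= Cmod z <= r2)%R -> exists l : C, has_Cderiv f z l) ->
  circle_int f r1 = circle_int f r2.
Proof.
intros [H1 H2] Hf. assert (Hp := two_PI_pos).
assert (Hln : (ln r1 <= ln r2)%R) by (apply ln_le; lra).
assert (G : rect_int (fun w => f (Cexp w)) (ln r1) 0 (ln r2 - ln r1) (2 * PI) = 0).
{ apply goursat_rectangle; [ lra | lra | ].
  intros u v Hu Hv.
  destruct (Hf (Cexp (u, v))) as [l Hl].
  - rewrite Cmod_Cexp. cbn [fst]. split.
    + rewrite <- (exp_ln r1) by assumption. apply exp_le_exp. lra.
    + rewrite <- (exp_ln r2) by lra. apply exp_le_exp. lra.
  - eexists. apply (has_Cderiv_comp f Cexp); [ exact Hl | apply has_Cderiv_Cexp ]. }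
unfold rect_int in G.
replace (ln r1 + (ln r2 - ln r1))%R with (ln r2) in G by ring.
rewrite (Cint_ext (fun t => f (Cexp (t, (0 + 2 * PI)%R))) (fun t => f (Cexp (t, 0%R)))) in G.
- rewrite Rplus_0_l in G.
  rewrite (Cint_ext (fun t => f (Cexp (ln r1, t))) (fun t => f (circle_point r1 t))) in G
    by (lra || (intros; now rewrite Cexp_circle_point by lra)).
  rewrite (Cint_ext (fun t => f (Cexp (ln r2, t))) (fun t => f (circle_point r2 t))) in G
    by (lra || (intros; now rewrite Cexp_circle_point by lra)).
  fold (circle_int f r1) (circle_int f r2) in G.
  replace (circle_int f r1) with (circle_int f r2 + Ci * (Ci * (circle_int f r2 - circle_int f r1))).
  + replace (Ci * (circle_int f r2 - circle_int f r1)) with (RtoC 0).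
    * ring.
    * rewrite <- G. ring.
  + replace (Ci * (Ci * (circle_int f r2 - circle_int f r1)))
      with ((Ci * Ci) * (circle_int f r2 - circle_int f r1)) by ring.
    replace (Ci * Ci) with (- (1)) by (apply injective_projections; simpl; ring).
    ring.
- lra.
- intros t _. f_equal. unfold Cexp. cbn [fst snd].
  now rewrite Rplus_0_l, cos_2PI, sin_2PI, cos_0, sin_0.
Qed.

Definition continuous_in_disk (f : C -> C) : Prop :=
  forall z : C, in_disk z -> continuous_C f z.

Lemma continuous_circle_point_2d (z : R * R) :
  continuous_C (fun z : R * R => circle_point (fst z) (snd z)) z.
Proof.
destruct z as [r t].
apply continuous_C_pair; apply (continuous_mult (K := R_AbsRing) (fun z : R * R => fst z)).
- apply continuous_fst.
- apply (continuous_comp (fun z : R * R => snd z) cos); [ apply continuous_snd | apply continuous_cos ].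
- apply continuous_fst.
- apply (continuous_comp (fun z : R * R => snd z) sin); [ apply continuous_snd | apply continuous_sin ].
Qed.

Lemma circle_int_continuous (f : C -> C) (r0 eps : R) :
  continuous_in_disk f -> (0 <= r0 < 1)%R -> (0 < eps)%R ->
  exists d : R, (0 < d)%R /\
    forall r : R, (0 <= r < 1)%R -> (Rabs (r - r0) < d)%R ->
      (Cmod (circle_int f r - circle_int f r0) <= eps)%R.
Proof.
intros Hf Hr0 He. assert (Hp := two_PI_pos).
(* A compact range of radii inside the disk, for uniform continuity. *)
set (R0 := ((1 + r0) / 2)%R).
assert (Hc : forall x y : R, (0 <= x <= R0)%R -> continuous_C (fun z : R * R => f (circle_point (fst z) (snd z))) (x, y)).
{ intros x y Hx. apply (continuous_comp (fun z : R * R => circle_point (fst z) (snd z)) f).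
  - apply continuous_circle_point_2d.
  - apply Hf. unfold in_disk. cbn [fst snd]. rewrite Cmod_circle_point; unfold R0 in Hx; lra. }
set (e := (eps / (4 * PI))%R).
assert (Hpi := PI_RGT_0).
assert (He' : (0 < e)%R) by (apply Rdiv_lt_0_compat; lra).
destruct (uniform_continuity_2d (fun x y => fst (f (circle_point x y))) 0 R0 0 (2 * PI)) with (eps := mkposreal e He') as [d1 Hd1].
{ intros x y Hx _. apply continuity_2d_pt_filterlim. exact (continuous_Re _ _ (Hc x y Hx)). }
destruct (uniform_continuity_2d (fun x y => snd (f (circle_point x y))) 0 R0 0 (2 * PI)) with (eps := mkposreal e He') as [d2 Hd2].
{ intros x y Hx _. apply continuity_2d_pt_filterlim. exact (continuous_Im _ _ (Hc x y Hx)). }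
exists (Rmin (Rmin d1 d2) (R0 - r0)). split.
{ repeat apply Rmin_glb_lt; [ apply d1 | apply d2 | unfold R0; lra ]. }
intros r Hr Hd.
assert (M1 := Rmin_l (Rmin d1 d2) (R0 - r0)). assert (M2 := Rmin_r (Rmin d1 d2) (R0 - r0)).
assert (M3 := Rmin_l d1 d2). assert (M4 := Rmin_r d1 d2).
assert (Hrr : (r <= R0)%R) by (assert (h := Rle_abs (r - r0)); lra).
assert (Hcr : forall s : R, (0 <= s < 1)%R -> continuous_on (fun t => f (circle_point s t)) 0 (2 * PI)).
{ intros s Hs. apply continuous_on_circle; [ lra | ]. intros z Hz. apply Hf. unfold in_disk. lra. }
unfold circle_int. rewrite <- Cint_minus by (lra || now apply Hcr).
eapply Rle_trans; [ apply (Cmod_Cint_le _ _ _ (2 * e)) | ].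
- lra.
- intros t Ht. apply (continuous_Cminus (fun t => f (circle_point r t)));
    [ now apply (Hcr r Hr) | now apply (Hcr r0 Hr0) ].
- intros t Ht. eapply Rle_trans; [ apply Cmod_le_abs | ].
  assert (A1 : (Rabs (fst (f (circle_point r t)) - fst (f (circle_point r0 t))) < e)%R).
  { apply (Hd1 r0 t r t); try (unfold R0 in *; lra). rewrite Rminus_eq_0, Rabs_R0. apply d1. }
  assert (A2 : (Rabs (snd (f (circle_point r t)) - snd (f (circle_point r0 t))) < e)%R).
  { apply (Hd2 r0 t r t); try (unfold R0 in *; lra). rewrite Rminus_eq_0, Rabs_R0. apply d2. }
  simpl. unfold Rminus in A1, A2. lra.
- unfold e. right. field. lra.
Qed.

Lemma C_eq_of_le_eps (x y : C) :
  (forall eps : R, (0 < eps)%R -> (Cmod (x - y) <= eps)%R) -> x = y.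
Proof.
intros H. replace x with (x - y + y) by ring.
rewrite (Cmod_eq_0 (x - y)); [ ring | ].
apply Rle_antisym; [ | apply Cmod_ge_0 ].
apply Rnot_lt_le. intros Hm. specialize (H (Cmod (x - y) / 2)%R ltac:(lra)). lra.
Qed.

Lemma circle_int_0 (f : C -> C) : circle_int f 0 = RtoC (2 * PI) * f 0.
Proof.
assert (Hp := two_PI_pos). unfold circle_int.
rewrite (Cint_ext _ (fun _ => f 0)).
- rewrite Cint_const. now rewrite Rminus_0_r.
- lra.
- intros t _. f_equal. unfold circle_point. apply injective_projections; simpl; ring.
Qed.

(** The circle integral is constant on either side of the radius rho, where f
    is only known to be continuous, and it is a continuous function of the
    radius down to 0. *)
Lemma circle_int_mean_value (f : C -> C) (rho r : R) :
  continuous_in_disk f -> (0 <= rho < 1)%R ->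
  (forall z : C, in_disk z -> z <> 0 -> Cmod z <> rho -> exists l : C, has_Cderiv f z l) ->
  (0 <= r < 1)%R -> circle_int f r = RtoC (2 * PI) * f 0.
Proof.
intros Hc Hrho Hf.
rewrite <- circle_int_0.
assert (Hnz : forall z : C, (0 < Cmod z)%R -> z <> 0).
{ intros z Hz. now apply Cmod_gt_0. }
assert (Hin : forall s : R, (0 <= s < rho)%R -> circle_int f s = circle_int f 0).
{ intros s Hs. destruct (Req_dec s 0) as [ -> | n ]; [ reflexivity | ].
  apply C_eq_of_le_eps. intros eps He.
  destruct (circle_int_continuous f 0 eps Hc ltac:(lra) He) as [d [Hd H]].
  set (t := Rmin s (d / 2)).
  assert (T1 := Rmin_l s (d / 2)). assert (T2 := Rmin_r s (d / 2)). fold t in T1, T2.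
  assert (Ht : (0 < t)%R) by (apply Rmin_glb_lt; lra).
  rewrite <- (circle_int_annulus f t s).
  - apply H; [ lra | rewrite Rminus_0_r, Rabs_pos_eq; lra ].
  - lra.
  - intros z Hz. apply Hf; [ unfold in_disk; lra | apply Hnz; lra | lra ]. }
assert (Hout : forall s : R, (rho < s < 1)%R -> circle_int f s = circle_int f rho).
{ intros s Hs. apply C_eq_of_le_eps. intros eps He.
  destruct (circle_int_continuous f rho eps Hc Hrho He) as [d [Hd H]].
  set (t := Rmin s (rho + d / 2)).
  assert (T1 := Rmin_l s (rho + d / 2)). assert (T2 := Rmin_r s (rho + d / 2)). fold t in T1, T2.
  assert (Ht : (rho < t)%R) by (apply Rmin_glb_lt; lra).
  rewrite <- (circle_int_annulus f t s).
  - apply H; [ lra | rewrite Rabs_pos_eq; lra ].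
  - lra.
  - intros z Hz. apply Hf; [ unfold in_disk; lra | apply Hnz; lra | lra ]. }
assert (Hat : circle_int f rho = circle_int f 0).
{ destruct (Req_dec rho 0) as [ -> | n ]; [ reflexivity | ].
  symmetry. apply C_eq_of_le_eps. intros eps He.
  destruct (circle_int_continuous f rho eps Hc Hrho He) as [d [Hd H]].
  set (t := Rmax 0 (rho - d / 2)).
  assert (T1 := Rmax_l 0 (rho - d / 2)). assert (T2 := Rmax_r 0 (rho - d / 2)). fold t in T1, T2.
  assert (Ht : (t < rho)%R) by (apply Rmax_lub_lt; lra).
  rewrite <- (Hin t) by lra. apply H; [ lra | ].
  rewrite Rabs_left1; lra. }
intros Hr. destruct (Rtotal_order r rho) as [ H | [ -> | H ] ].
- now apply Hin.
- exact Hat.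
- rewrite Hout by lra. exact Hat.
Qed.

(** * Cauchy's formula and the maximum principle *)

Lemma circle_neq (a z : C) (r : R) : (Cmod a < r)%R -> Cmod z = r -> z - a <> 0.
Proof.
intros Ha Hz. apply Cminus_neq_0. intros ->. lra.
Qed.

Lemma Cmod_pos_neq_0 (z : C) (r : R) : (0 < r)%R -> Cmod z = r -> z <> 0.
Proof. intros Hr Hz. apply Cmod_gt_0. lra. Qed.

Lemma Cmod_lt_1_neq (w : C) : (Cmod w < 1)%R -> 1 - w <> 0.
Proof. intros Hw. apply Cminus_neq_0. intros <-. rewrite Cmod_1 in Hw. lra. Qed.

(** On the circle |z| = r the kernel z / (z - a) is the conjugate of
    1 / (1 - conj(a) z / r^2), which is holomorphic inside and takes the value
    1 at the centre.  Rescaling to a radius t < 1 brings its domain into the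
    unit disk. *)
Lemma circle_int_kernel (a : C) (r : R) :
  (Cmod a < r)%R -> circle_int (fun z => z / (z - a)) r = RtoC (2 * PI).
Proof.
intros Ha. assert (Hp := two_PI_pos).
assert (Hr : (0 < r)%R) by (assert (h := Cmod_ge_0 a); lra).
set (q := (Cmod a / r)%R).
assert (Hq : (0 <= q < 1)%R).
{ unfold q. split.
  - apply Rmult_le_pos; [ apply Cmod_ge_0 | now apply Rlt_le, Rinv_0_lt_compat ].
  - apply (Rmult_lt_reg_r r); [ assumption | ]. unfold Rdiv.
    rewrite Rmult_assoc, Rinv_l by lra. lra. }
set (t := ((1 + q) / 2)%R).
assert (Ht : (q < t < 1)%R) by (unfold t; lra).
set (c := Cconj a / RtoC (r * t)).
assert (Hrt : (0 < r * t)%R) by (apply Rmult_lt_0_compat; lra).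
assert (Hrt' : RtoC (r * t) <> 0) by (intros E; apply RtoC_inj in E; lra).
assert (Hc : (Cmod c <= 1)%R).
{ unfold c. rewrite Cmod_div by assumption. rewrite Cmod_conj, Cmod_R, Rabs_pos_eq by lra.
  replace (Cmod a) with (q * r)%R by (unfold q; field; lra).
  apply (Rmult_le_reg_r (r * t)); [ assumption | ].
  unfold Rdiv. rewrite Rmult_assoc, Rinv_l by lra. nra. }
set (h := fun z : C => / (1 - c * z)).
assert (Hdisk : forall z : C, in_disk z -> 1 - c * z <> 0).
{ intros z Hz. apply Cmod_lt_1_neq. rewrite Cmod_mult.
  unfold in_disk in Hz. assert (h1 := Cmod_ge_0 c). assert (h2 := Cmod_ge_0 z). nra. }
assert (Hd : forall z : C, in_disk z -> exists l : C, has_Cderiv h z l).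
{ intros z Hz. eexists. apply has_Cderiv_inv; [ | now apply Hdisk ].
  apply has_Cderiv_minus; [ apply has_Cderiv_const | ].
  apply has_Cderiv_mult; [ apply has_Cderiv_const | apply has_Cderiv_id ]. }
assert (Hhc : continuous_in_disk h).
{ intros z Hz. destruct (Hd z Hz) as [l Hl]. now apply has_Cderiv_continuous in Hl. }
assert (E : circle_int h t = RtoC (2 * PI)).
{ rewrite (circle_int_mean_value h 0 t).
  - unfold h. replace (1 - c * 0) with (RtoC 1) by ring. field.
  - assumption.
  - lra.
  - intros z Hz _ _. now apply Hd.
  - lra. }
transitivity (Cconj (circle_int h t)).
- unfold circle_int. rewrite <- Cint_conj.
  + apply Cint_ext; [ lra | ]. intros s _.
    set (z := circle_point r s).
    assert (Hz : Cmod z = r) by (apply Cmod_circle_point; lra).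
    assert (Hzz : z * Cconj z = RtoC (r * r)).
    { rewrite <- Cmod2_conj, Hz. f_equal. ring. }
    assert (Hz0 := Cmod_pos_neq_0 z r Hr Hz).
    assert (Hconj0 : Cconj z <> 0).
    { intros F. apply Hz0. rewrite <- (Cconj_conj z), F. apply injective_projections; simpl; ring. }
    assert (Hza := circle_neq a z r Ha Hz).
    assert (Hr' : RtoC r <> 0) by (intros F; apply RtoC_inj in F; lra).
    assert (Ht' : RtoC t <> 0) by (intros F; apply RtoC_inj in F; lra).
    assert (Hpt : circle_point t s = RtoC (t / r) * z).
    { unfold z, circle_point. apply injective_projections; simpl; field; lra. }
    assert (Hcz : Cconj (c * circle_point t s) = a / z).
    { unfold c. rewrite Hpt, RtoC_mult, RtoC_div by lra.
      replace (Cconj a / (r * t) * (t / r * z)) with (Cconj a * z * / (r * r)).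
      - rewrite <- RtoC_mult, <- Hzz.
        replace (Cconj a * z * / (z * Cconj z)) with (Cconj a / Cconj z).
        + now rewrite Cdiv_conj, !Cconj_conj.
        + field. now split.
      - field. now split. }
    unfold h. rewrite Cinv_conj.
    * rewrite Cminus_conj, Hcz.
      replace (Cconj 1) with (RtoC 1) by (apply injective_projections; simpl; ring).
      field. split; [ assumption | ].
      intros F. apply Hza. rewrite <- F. ring.
    * apply Hdisk. unfold in_disk. rewrite Cmod_circle_point; lra.
  + lra.
  + apply continuous_on_circle; [ lra | ]. intros z Hz. apply Hhc. unfold in_disk. lra.
- rewrite E. apply injective_projections; simpl; ring.
Qed.

(** The mean value property of z (f z - f a) / (z - a), which is holomorphic
    off a and 0 and vanishes at the origin.  The origin is left exceptional for f
    so that the formula applies to difference quotients at 0. *)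
Lemma cauchy_formula (f : C -> C) (a : C) (r : R) :
  continuous_in_disk f ->
  (forall z : C, in_disk z -> z <> 0 -> exists l : C, has_Cderiv f z l) ->
  (Cmod a < r < 1)%R ->
  circle_int (fun z => f z * (z / (z - a))) r = RtoC (2 * PI) * f a.
Proof.
intros Hc Hd [Ha Hr].
assert (Hma := Cmod_ge_0 a).
assert (Haz : in_disk a) by (unfold in_disk; lra).
(* The extension Q of z (f z - f a) / (z - a) to a: for a = 0 it is f z - f 0,
   otherwise the slope of f at a provides it. *)
assert (HQ : exists Q : C -> C, continuous_C Q a /\ Q 0 = 0 /\
  forall z : C, z <> a -> Q z = z * ((f z - f a) / (z - a))).
{ destruct (Ceq_dec a 0) as [ -> | n ].
  - exists (fun z => f z - f 0). split; [ | split ].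
    + apply continuous_Cminus; [ now apply Hc | apply continuous_const ].
    + ring.
    + intros z Hz. field. intros F. apply Hz. rewrite <- F. ring.
  - destruct (Hd a Haz n) as [l [phi [Hphi [_ Hslope]]]].
    exists (fun z => z * phi z). split; [ | split ].
    + apply continuous_Cmult; [ apply continuous_id | assumption ].
    + ring.
    + intros z Hz. rewrite Hslope. field. now apply Cminus_neq_0. }
destruct HQ as [Q [HQa [HQ0 HQ]]].
assert (Hnear : forall z w : C, (Cmod (w - z) < Cmod (z - a))%R ->
  w * ((f w - f a) / (w - a)) = Q w).
{ intros z w Hw. symmetry. apply HQ. intros ->.
  rewrite <- (Cmod_opp (a - z)) in Hw.
  replace (- (a - z)) with (z - a) in Hw by ring. lra. }
assert (HQd : forall z : C, in_disk z -> z <> 0 -> z <> a -> exists l : C, has_Cderiv Q z l).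
{ intros z Hz H0 Hza. destruct (Hd z Hz H0) as [l Hl]. eexists.
  apply (has_Cderiv_ext_near (fun w => w * ((f w - f a) / (w - a))) Q z _ (Cmod (z - a))).
  - now apply Cmod_gt_0, Cminus_neq_0.
  - apply Hnear.
  - apply has_Cderiv_mult; [ apply has_Cderiv_id | ].
    apply has_Cderiv_mult.
    + apply has_Cderiv_minus; [ exact Hl | apply has_Cderiv_const ].
    + apply has_Cderiv_inv; [ | now apply Cminus_neq_0 ].
      apply has_Cderiv_minus; [ apply has_Cderiv_id | apply has_Cderiv_const ]. }
assert (HQc : continuous_in_disk Q).
{ intros z Hz. destruct (Ceq_dec z a) as [ -> | n ]; [ assumption | ].
  apply (continuous_ext_near (fun w => w * ((f w - f a) / (w - a))) Q z (Cmod (z - a))).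
  - now apply Cmod_gt_0, Cminus_neq_0.
  - apply Hnear.
  - apply continuous_Cmult; [ apply continuous_id | ].
    apply continuous_Cmult.
    + apply continuous_Cminus; [ now apply Hc | apply continuous_const ].
    + apply continuous_Cinv; [ | now apply Cminus_neq_0 ].
      apply continuous_Cminus; [ apply continuous_id | apply continuous_const ]. }
assert (E : circle_int Q r = 0).
{ rewrite (circle_int_mean_value Q (Cmod a) r).
  - rewrite HQ0. ring.
  - assumption.
  - lra.
  - intros z Hz H0 Hza. apply HQd; [ assumption | assumption | ]. now intros ->.
  - lra. }
assert (Hkc : forall z : C, Cmod z = r -> continuous_C (fun z => z / (z - a)) z).
{ intros z Hz. apply continuous_Cmult; [ apply continuous_id | ].
  apply continuous_Cinv; [ | now apply (circle_neq a z r) ].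
  apply continuous_Cminus; [ apply continuous_id | apply continuous_const ]. }
rewrite (circle_int_ext Q (fun z => f z * (z / (z - a)) - f a * (z / (z - a)))) in E.
- rewrite circle_int_minus in E.
  + rewrite circle_int_scal, circle_int_kernel in E by (lra || assumption).
    replace (circle_int (fun z => f z * (z / (z - a))) r)
      with (circle_int (fun z => f z * (z / (z - a))) r - f a * RtoC (2 * PI) + f a * RtoC (2 * PI)) by ring.
    rewrite E. ring.
  + lra.
  + intros z Hz. apply continuous_Cmult; [ | now apply Hkc ]. apply Hc. unfold in_disk; lra.
  + intros z Hz. apply continuous_Cmult; [ apply continuous_const | now apply Hkc ].
- lra.
- intros z Hz. assert (Hza := circle_neq a z r Ha Hz).
  rewrite HQ.
  + field. assumption.
  + intros ->. apply Hza. ring.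
Qed.

Lemma le_of_pow_le_mult (x B K : R) :
  (0 <= B)%R -> (forall n : nat, (x ^ n <= K * B ^ n)%R) -> (x <= B)%R.
Proof.
intros HB H. apply Rnot_lt_le. intros Hlt.
assert (Hx : (0 < x)%R) by lra.
assert (HK : (1 <= K)%R) by (specialize (H O); simpl in H; lra).
assert (Hq : (0 <= B / x < 1)%R).
{ split.
  - apply Rmult_le_pos; [ assumption | now apply Rlt_le, Rinv_0_lt_compat ].
  - apply (Rmult_lt_reg_r x); [ assumption | ]. unfold Rdiv.
    rewrite Rmult_assoc, Rinv_l by lra. lra. }
destruct (pow_lt_1_zero (B / x) ltac:(rewrite Rabs_pos_eq; lra) (/ K) ltac:(apply Rinv_0_lt_compat; lra)) as [N HN].
specialize (HN N (Nat.le_refl N)). rewrite Rabs_pos_eq in HN by (apply pow_le; lra).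
specialize (H N).
assert (Hxn : (0 < x ^ N)%R) by now apply pow_lt.
assert (E : (B ^ N = (B / x) ^ N * x ^ N)%R).
{ rewrite <- Rpow_mult_distr. f_equal. field. lra. }
rewrite E in H.
apply (Rmult_lt_compat_l K) in HN; [ | lra ]. rewrite Rinv_r in HN by lra. nra.
Qed.

Lemma Cmod_kernel_le (a z : C) (r : R) :
  (Cmod a < r)%R -> Cmod z = r -> (Cmod (z / (z - a)) <= r / (r - Cmod a))%R.
Proof.
intros Ha Hz. assert (H0 := Cmod_ge_0 a).
rewrite Cmod_div by now apply (circle_neq a z r).
rewrite Hz. apply Rmult_le_compat_l; [ lra | ].
apply Rinv_le_contravar; [ lra | ].
assert (T := Cmod_triangle (z - a) a). replace (z - a + a) with z in T by ring. lra.
Qed.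

(** Landau's argument: Cauchy's formula for f^n loses a constant factor
    independent of n, which disappears in the limit of n-th roots. *)
Lemma maximum_modulus (f : C -> C) (a : C) (r B : R) :
  continuous_in_disk f ->
  (forall z : C, in_disk z -> z <> 0 -> exists l : C, has_Cderiv f z l) ->
  (Cmod a < r < 1)%R -> (forall z : C, Cmod z = r -> (Cmod (f z) <= B)%R) ->
  (Cmod (f a) <= B)%R.
Proof.
intros Hc Hd [Ha Hr] HB.
assert (H0 := Cmod_ge_0 a). assert (Hp := two_PI_pos).
assert (HB0 : (0 <= B)%R).
{ eapply Rle_trans; [ apply Cmod_ge_0 | apply (HB (circle_point r 0)) ].
  apply Cmod_circle_point. lra. }
apply (le_of_pow_le_mult _ _ (r / (r - Cmod a))); [ assumption | ].
intros n. rewrite <- Cmod_pow.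
assert (Hcn : continuous_in_disk (fun z => f z ^ n)).
{ intros z Hz. now apply continuous_Cpow, Hc. }
assert (E : circle_int (fun z => f z ^ n * (z / (z - a))) r = RtoC (2 * PI) * f a ^ n).
{ apply (cauchy_formula (fun z => f z ^ n)); [ assumption | | lra ].
  intros z Hz Hz0. destruct (Hd z Hz Hz0) as [l Hl]. now apply (has_Cderiv_pow f n z l). }
assert (I : (Cmod (circle_int (fun z => f z ^ n * (z / (z - a)))%C r) <= 2 * PI * (r / (r - Cmod a) * B ^ n))%R).
{ apply circle_int_bound; [ lra | | ].
  - intros z Hz. apply continuous_Cmult; [ apply Hcn; unfold in_disk; lra | ].
    apply continuous_Cmult; [ apply continuous_id | ].
    apply continuous_Cinv; [ | now apply (circle_neq a z r) ].
    apply continuous_Cminus; [ apply continuous_id | apply continuous_const ].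
  - intros z Hz. rewrite Cmod_mult, Rmult_comm, Cmod_pow.
    apply Rmult_le_compat; [ apply Cmod_ge_0 | apply pow_le, Cmod_ge_0 | now apply Cmod_kernel_le | ].
    apply pow_incr. split; [ apply Cmod_ge_0 | now apply HB ]. }
rewrite E, Cmod_mult, Cmod_R, Rabs_pos_eq in I by lra.
now apply Rmult_le_reg_l in I.
Qed.

Lemma analytic_in_disk_has_Cderiv (f : C -> C) :
  analytic_in_disk f -> forall z : C, in_disk z -> exists l : C, has_Cderiv f z l.
Proof.
intros Hf z Hz. destruct (Hf z Hz) as [l Hl]. exists l. now apply is_derive_has_Cderiv.
Qed.

Lemma analytic_in_disk_continuous (f : C -> C) :
  analytic_in_disk f -> continuous_in_disk f.
Proof.
intros Hf z Hz. destruct (analytic_in_disk_has_Cderiv f Hf z Hz) as [l Hl].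
now apply has_Cderiv_continuous in Hl.
Qed.

(** This is the maximum principle for w(z) / z on circles of radius tending to 1. *)
Lemma schwarz_lemma (w : C -> C) (z : C) :
  analytic_in_disk w -> w 0 = 0 -> (forall z : C, in_disk z -> in_disk (w z)) ->
  in_disk z -> (Cmod (w z) <= Cmod z)%R.
Proof.
intros Hw H0 Hin Hz.
assert (Hz0 : in_disk 0) by (unfold in_disk; rewrite Cmod_0; lra).
(* The slope of w at 0 is w(z) / z with its removable singularity filled. *)
destruct (analytic_in_disk_has_Cderiv w Hw 0 Hz0) as [l [phi [Hphi [_ Hslope]]]].
assert (Hs : forall u : C, w u = phi u * u).
{ intros u. specialize (Hslope u). rewrite H0 in Hslope.
  replace (w u) with (w u - 0) by ring. rewrite Hslope. ring. }
assert (Hquot : forall u v : C, (Cmod (v - u) < Cmod u)%R -> w v / v = phi v).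
{ intros u v Hv. rewrite Hs. field. intros ->.
  replace (0 - u) with (- u) in Hv by ring. rewrite Cmod_opp in Hv. lra. }
assert (Hd : forall u : C, in_disk u -> u <> 0 -> exists m : C, has_Cderiv phi u m).
{ intros u Hu Hu0. destruct (analytic_in_disk_has_Cderiv w Hw u Hu) as [m Hm]. eexists.
  apply (has_Cderiv_ext_near (fun v => w v / v) phi u _ (Cmod u)).
  - now apply Cmod_gt_0.
  - apply Hquot.
  - apply has_Cderiv_mult; [ exact Hm | ].
    apply has_Cderiv_inv; [ apply has_Cderiv_id | assumption ]. }
assert (Hc : continuous_in_disk phi).
{ intros u Hu. destruct (Ceq_dec u 0) as [ -> | n ]; [ assumption | ].
  destruct (Hd u Hu n) as [m Hm]. now apply has_Cderiv_continuous in Hm. }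
rewrite Hs, Cmod_mult. rewrite <- (Rmult_1_l (Cmod z)) at 2.
apply Rmult_le_compat_r; [ apply Cmod_ge_0 | ].
assert (Hr : forall r : R, (Cmod z < r < 1)%R -> (Cmod (phi z) * r <= 1)%R).
{ intros r Hr. assert (hz := Cmod_ge_0 z).
  assert (M : (Cmod (phi z) <= / r)%R).
  { apply (maximum_modulus phi z r); try assumption. intros u Hu.
    assert (Hu1 : in_disk u) by (unfold in_disk; lra).
    specialize (Hin u Hu1). unfold in_disk in Hin. rewrite Hs, Cmod_mult, Hu in Hin.
    apply (Rmult_le_reg_r r); [ lra | ]. rewrite Rinv_l by lra. lra. }
  apply (Rmult_le_compat_r r) in M; [ | lra ]. rewrite Rinv_l in M by lra. exact M. }
unfold in_disk in Hz. assert (hz := Cmod_ge_0 z).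
apply Rnot_lt_le. intros Hgt.
(* A radius close enough to 1 that |phi z| r exceeds 1. *)
set (r := Rmax ((1 + Cmod z) / 2) ((1 + / Cmod (phi z)) / 2)).
assert (Hinv : (Cmod (phi z) * / Cmod (phi z) = 1)%R) by (apply Rinv_r; lra).
assert (Hlt : (/ Cmod (phi z) < 1)%R).
{ rewrite <- Rinv_1. apply Rinv_lt_contravar; lra. }
assert (R1 := Rmax_l ((1 + Cmod z) / 2) ((1 + / Cmod (phi z)) / 2)).
assert (R2 := Rmax_r ((1 + Cmod z) / 2) ((1 + / Cmod (phi z)) / 2)).
fold r in R1, R2.
assert (R3 : (r < 1)%R) by (apply Rmax_lub_lt; lra).
specialize (Hr r ltac:(lra)). nra.
Qed.

(** This is the maximum principle for exp(-p), whose modulus is exp(-Re p). *)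
Lemma minimum_principle_Re (p : C -> C) (a : C) (r m : R) :
  analytic_in_disk p -> (r < 1)%R -> (Cmod a <= r)%R ->
  (forall z : C, Cmod z = r -> (m <= Re (p z))%R) -> (m <= Re (p a))%R.
Proof.
intros Hp Hr [ Ha | Ha ] Hm; [ | now apply Hm ].
assert (Hd : forall z : C, in_disk z -> exists l : C, has_Cderiv (fun z => Cexp (- p z)) z l).
{ intros z Hz. destruct (analytic_in_disk_has_Cderiv p Hp z Hz) as [l Hl]. eexists.
  apply (has_Cderiv_comp Cexp (fun z => - p z)); [ apply has_Cderiv_Cexp | ].
  apply has_Cderiv_opp. exact Hl. }
assert (M : (Cmod (Cexp (- p a)) <= exp (- m))%R).
{ apply (maximum_modulus (fun z => Cexp (- p z)) a r).
  - intros z Hz. destruct (Hd z Hz) as [l Hl]. now apply has_Cderiv_continuous in Hl.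
  - intros z Hz _. now apply Hd.
  - lra.
  - intros z Hz. rewrite Cmod_Cexp. apply exp_le_exp. simpl.
    specialize (Hm z Hz). unfold Re in Hm. lra. }
rewrite Cmod_Cexp in M. simpl in M.
apply Rnot_lt_le. intros Hlt.
assert (X := exp_increasing (- m) (- fst (p a))). unfold Re in Hlt. lra.
Qed.

(** * Taylor expansions *)

Definition Cseq_lim (u : nat -> C) (l : C) : Prop :=
  forall eps : R, (0 < eps)%R -> exists N : nat, forall n : nat, (N <= n)%nat ->
    (Cmod (u n - l) < eps)%R.

Definition power_sum (c : nat -> C) (z : C) (n : nat) : C :=
  sum_n (G := C_AbelianMonoid) (fun k => z ^ k * c k) n.

Lemma power_sum_S (c : nat -> C) (z : C) (n : nat) :
  power_sum c z (S n) = power_sum c z n + z ^ S n * c (S n).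
Proof. unfold power_sum. now rewrite sum_Sn. Qed.

Lemma power_sum_O (c : nat -> C) (z : C) : power_sum c z 0 = c 0%nat.
Proof. unfold power_sum. rewrite sum_O. simpl. ring. Qed.

Lemma pow_n_Cpow (z : C) (n : nat) : pow_n (K := C_Ring) z n = z ^ n.
Proof. induction n as [ | n IH ]; [ reflexivity | ]. simpl. now rewrite IH. Qed.

Lemma is_pseries_C_iff (c : nat -> C) (z l : C) :
  is_pseries (K := C_AbsRing) (V := C_NormedModule) c z l <-> Cseq_lim (power_sum c z) l.
Proof.
assert (E : forall n : nat,
  sum_n (G := C_AbelianMonoid) (fun k => scal (V := C_ModuleSpace) (pow_n (K := C_Ring) z k) (c k)) n = power_sum c z n).
{ intros n. apply sum_n_ext. intros k. now rewrite pow_n_Cpow. }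
split.
- intros H eps He.
  assert (He' : (0 < eps / 2)%R) by lra.
  destruct (proj1 (filterlim_locally _ _) H (mkposreal _ He')) as [N HN].
  exists N. intros n Hn. specialize (HN n Hn).
  apply C_NormedModule_mixin_compat2 in HN. rewrite <- E.
  eapply Rlt_trans; [ exact HN | ]. simpl pos.
  assert (H3 := sqrt_pos 2). assert (H4 := sqrt_sqrt 2 ltac:(lra)). nra.
- intros H. apply filterlim_locally. intros eps.
  destruct (H eps (cond_pos eps)) as [N HN].
  exists N. intros n Hn. apply C_NormedModule_mixin_compat1.
  specialize (HN n Hn). rewrite <- E in HN. exact HN.
Qed.

Lemma bounded_on_circle (f : C -> C) (r : R) :
  (0 <= r)%R -> (forall z : C, Cmod z = r -> continuous_C f z) ->
  exists M : R, forall t : R, (0 <= t <= 2 * PI)%R -> (Cmod (f (circle_point r t)) <= M)%R.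
Proof.
intros Hr Hf. assert (Hp := two_PI_pos).
assert (Hc := continuous_on_circle f r 0 (2 * PI) Hr Hf).
set (u := fun t => (Rabs (fst (f (circle_point r t))) + Rabs (snd (f (circle_point r t))))%R).
destruct (continuity_ab_maj u 0 (2 * PI)) as [s [Hs _]].
- lra.
- intros t Ht. apply continuity_pt_filterlim.
  apply (continuous_plus (fun t => Rabs (fst (f (circle_point r t)))) (fun t => Rabs (snd (f (circle_point r t))))).
  + apply (continuous_comp (fun t => fst (f (circle_point r t))) Rabs); [ | apply continuous_Rabs ].
    apply (continuous_Re (fun t => f (circle_point r t))). now apply Hc.
  + apply (continuous_comp (fun t => snd (f (circle_point r t))) Rabs); [ | apply continuous_Rabs ].
    apply (continuous_Im (fun t => f (circle_point r t))). now apply Hc.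
- exists (u s). intros t Ht. eapply Rle_trans; [ apply Cmod_le_abs | now apply Hs ].
Qed.

(** Expanding the Cauchy kernel in a geometric series.  The coefficients are
    integrals over one fixed circle; on any other circle they take the same
    values, which gives convergence in the whole disk. *)
Lemma taylor_in_disk (f : C -> C) :
  continuous_in_disk f ->
  (forall z : C, in_disk z -> z <> 0 -> exists l : C, has_Cderiv f z l) ->
  exists c : nat -> C,
    (forall z : C, in_disk z -> is_pseries (K := C_AbsRing) (V := C_NormedModule) c z (f z)) /\
    (forall r : R, (0 < r < 1)%R -> exists M : R, forall k : nat, (Cmod (c k) * r ^ k <= M)%R).
Proof.
intros Hc Hd. assert (Hp := two_PI_pos).
assert (Hp' : RtoC (2 * PI) <> 0) by (intros F; apply RtoC_inj in F; lra).
set (J := fun (r : R) (k : nat) => circle_int (fun z => f z * / z ^ k) r).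
assert (Hnz : forall z : C, (0 < Cmod z)%R -> z <> 0) by (intros z Hz; now apply Cmod_gt_0).
assert (Hle : forall r s k, (0 < r <= s)%R -> (s < 1)%R -> J r k = J s k).
{ intros r s k Hrs Hs. apply circle_int_annulus; [ assumption | ].
  intros z Hz. assert (Hz0 : z <> 0) by (apply Hnz; lra).
  destruct (Hd z ltac:(unfold in_disk; lra) Hz0) as [l Hl].
  destruct (has_Cderiv_pow (fun w => w) k z 1 (has_Cderiv_id z)) as [m Hm].
  eexists. apply has_Cderiv_mult; [ exact Hl | ].
  apply (has_Cderiv_inv (fun w => w ^ k)); [ exact Hm | now apply Cpow_nz ]. }
assert (HJ : forall r k, (0 < r < 1)%R -> J r k = J (1 / 2)%R k).
{ intros r k Hr. destruct (Rle_dec r (1 / 2)).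
  - apply Hle; lra.
  - symmetry. apply Hle; lra. }
exists (fun k => / RtoC (2 * PI) * J (1 / 2)%R k).
assert (Hcr : forall r z, (0 < r < 1)%R -> Cmod z = r -> continuous_C f z).
{ intros r z Hr Hz. apply Hc. unfold in_disk. lra. }
assert (Hik : forall (k : nat) r z, (0 < r < 1)%R -> Cmod z = r -> continuous_C (fun z => / z ^ k) z).
{ intros k r z Hr Hz. apply (continuous_Cinv (fun z => z ^ k)).
  - apply continuous_Cpow, continuous_id.
  - apply Cpow_nz, Hnz. lra. }
(* Points of the circle come with an angle in [0, 2 pi], where compactness
   bounds f. *)
assert (HM : forall r, (0 < r < 1)%R -> exists M : R,
  forall z : C, Cmod z = r -> (exists t : R, (0 <= t <= 2 * PI)%R /\ z = circle_point r t) -> (Cmod (f z) <= M)%R).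
{ intros r Hr. destruct (bounded_on_circle f r) as [M HM].
  - lra.
  - intros z Hz. now apply (Hcr r).
  - exists M. intros z _ [t [Ht ->]]. now apply HM. }
assert (HI : forall (g : C -> C) r M, (0 < r < 1)%R -> (forall z : C, Cmod z = r -> continuous_C g z) ->
  (forall z : C, Cmod z = r -> (exists t : R, (0 <= t <= 2 * PI)%R /\ z = circle_point r t) -> (Cmod (g z) <= M)%R) ->
  (Cmod (circle_int g r) <= 2 * PI * M)%R).
{ intros g r M Hr Hg HgM. unfold circle_int.
  replace (2 * PI * M)%R with ((2 * PI - 0) * M)%R by ring.
  apply Cmod_Cint_le.
  - lra.
  - apply continuous_on_circle; [ lra | assumption ].
  - intros t Ht. apply HgM; [ apply Cmod_circle_point; lra | now exists t ]. }
split.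
- intros z Hz. apply is_pseries_C_iff. intros eps He.
  unfold in_disk in Hz. assert (hz := Cmod_ge_0 z).
  set (r := ((1 + Cmod z) / 2)%R).
  assert (Hr : (0 < r < 1)%R) by (unfold r; lra).
  assert (Hzr : (Cmod z < r)%R) by (unfold r; lra).
  destruct (HM r Hr) as [M HMr].
  assert (HM0 : (0 <= M)%R).
  { eapply Rle_trans; [ apply Cmod_ge_0 | ]. apply (HMr (circle_point r 0)).
    - apply Cmod_circle_point; lra.
    - exists 0%R. split; [ lra | reflexivity ]. }
  set (K := (r / (r - Cmod z))%R).
  assert (HK : (0 < K)%R) by (apply Rdiv_lt_0_compat; lra).
  (* 2 pi times the Taylor remainder at z after n terms is the integral of rem n. *)
  set (rem := fun (n : nat) (w : C) => f w * (w / (w - z)) * (z / w) ^ n).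
  assert (Hremc : forall n w, Cmod w = r -> continuous_C (rem n) w).
  { intros n w Hw. apply continuous_Cmult.
    - apply continuous_Cmult; [ now apply (Hcr r) | ].
      apply continuous_Cmult; [ apply continuous_id | ].
      apply continuous_Cinv; [ | now apply (circle_neq z w r) ].
      apply continuous_Cminus; [ apply continuous_id | apply continuous_const ].
    - apply continuous_Cpow, continuous_Cmult; [ apply continuous_const | ].
      apply continuous_Cinv; [ apply continuous_id | apply Hnz; lra ]. }
  assert (Hterm : forall n, circle_int (rem n) r - circle_int (rem (S n)) r = z ^ n * J (1 / 2)%R n).
  { intros n. rewrite <- (HJ r n Hr). unfold J.
    rewrite <- circle_int_scal, <- circle_int_minus.
    - apply circle_int_ext; [ lra | ]. intros w Hw.
      assert (Hw0 : w <> 0) by (apply Hnz; lra).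
      assert (Hwz := circle_neq z w r Hzr Hw).
      assert (Hwn := Cpow_nz w n Hw0).
      unfold rem, Cdiv. rewrite Cpow_S, Cpow_mult_l, Cpow_inv by assumption.
      field. repeat split; assumption.
    - lra.
    - intros w Hw. now apply Hremc.
    - intros w Hw. now apply Hremc.
    - lra.
    - intros w Hw. apply continuous_Cmult; [ now apply (Hcr r) | now apply (Hik n r) ]. }
  assert (Hsum : forall n, f z - power_sum (fun k => / RtoC (2 * PI) * J (1 / 2)%R k) z n
                   = / RtoC (2 * PI) * circle_int (rem (S n)) r).
  { assert (H0 : f z = / RtoC (2 * PI) * circle_int (rem 0%nat) r).
    { rewrite (circle_int_ext (rem 0%nat) (fun w => f w * (w / (w - z)))).
      - rewrite cauchy_formula by (assumption || lra). field. assumption.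
      - lra.
      - intros w _. unfold rem. simpl. ring. }
    induction n as [ | n IH ].
    - rewrite power_sum_O, H0.
      specialize (Hterm 0%nat). simpl Cpow in Hterm. rewrite Cmult_1_l in Hterm.
      rewrite <- Hterm. ring.
    - rewrite power_sum_S.
      replace (f z - (power_sum (fun k => / (2 * PI)%R * J (1 / 2)%R k) z n + z ^ S n * (/ (2 * PI)%R * J (1 / 2)%R (S n))))
        with (f z - power_sum (fun k => / (2 * PI)%R * J (1 / 2)%R k) z n - / (2 * PI)%R * (z ^ S n * J (1 / 2)%R (S n))) by ring.
      rewrite IH, <- Hterm. ring. }
  assert (Hq : (0 <= Cmod z / r < 1)%R).
  { split.
    - apply Rmult_le_pos; [ assumption | apply Rlt_le, Rinv_0_lt_compat; lra ].
    - apply (Rmult_lt_reg_r r); [ lra | ]. unfold Rdiv.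
      rewrite Rmult_assoc, Rinv_l by lra. lra. }
  assert (Hrem : forall n, (Cmod (circle_int (rem n) r) <= 2 * PI * (M * K * (Cmod z / r) ^ n))%R).
  { intros n. apply HI; [ assumption | apply Hremc | ].
    intros w Hw Hwt. unfold rem. rewrite !Cmod_mult, Cmod_pow.
    assert (Hw0 : w <> 0) by (apply Hnz; lra).
    rewrite (Cmod_div z w), Hw by assumption.
    apply Rmult_le_compat_r; [ now apply pow_le | ].
    apply Rmult_le_compat; try apply Cmod_ge_0.
    - now apply HMr.
    - now apply Cmod_kernel_le. }
  assert (HMK : (0 < M * K + 1)%R) by nra.
  destruct (pow_lt_1_zero (Cmod z / r) ltac:(rewrite Rabs_pos_eq; lra) (eps / (M * K + 1)) ltac:(apply Rdiv_lt_0_compat; lra)) as [N HN].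
  exists N. intros n Hn.
  rewrite <- Cmod_opp.
  replace (- (power_sum (fun k => / (2 * PI)%R * J (1 / 2)%R k) z n - f z))
    with (f z - power_sum (fun k => / (2 * PI)%R * J (1 / 2)%R k) z n) by ring.
  rewrite Hsum, Cmod_mult, Cmod_inv by assumption.
  rewrite Cmod_R, Rabs_pos_eq by lra.
  assert (HNn := HN (S n) ltac:(lia)). rewrite Rabs_pos_eq in HNn by (now apply pow_le).
  assert (HR := Hrem (S n)).
  apply (Rle_lt_trans _ (M * K * (Cmod z / r) ^ S n)).
  + apply (Rmult_le_reg_l (2 * PI)); [ assumption | ].
    rewrite <- Rmult_assoc, Rinv_r, Rmult_1_l by lra. exact HR.
  + apply (Rmult_lt_compat_l (M * K + 1)) in HNn; [ | assumption ].
    replace ((M * K + 1) * (eps / (M * K + 1)))%R with eps in HNn by (field; lra).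
    assert (h := pow_le (Cmod z / r) (S n) (proj1 Hq)). lra.
- intros r Hr. destruct (HM r Hr) as [M HMr].
  exists M. intros k. rewrite <- (HJ r k Hr). rewrite Cmod_mult, Cmod_inv by assumption.
  rewrite Cmod_R, Rabs_pos_eq by lra.
  assert (Hrk : (0 < r ^ k)%R) by (apply pow_lt; lra).
  assert (HJk : (Cmod (J r k) <= 2 * PI * (M * / r ^ k))%R).
  { apply HI; [ assumption | | ].
    - intros z Hz. apply continuous_Cmult; [ now apply (Hcr r) | now apply (Hik k r) ].
    - intros z Hz Hzt. assert (Hz0 : z <> 0) by (apply Hnz; lra).
      rewrite Cmod_mult, Cmod_inv by now apply Cpow_nz.
      rewrite Cmod_pow, Hz. apply Rmult_le_compat_r; [ now apply Rlt_le, Rinv_0_lt_compat | ].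
      now apply HMr. }
  apply (Rmult_le_compat_l (/ (2 * PI) * r ^ k)) in HJk.
  + replace (/ (2 * PI) * r ^ k * (2 * PI * (M * / r ^ k)))%R with M in HJk by (field; split; lra).
    lra.
  + apply Rmult_le_pos; [ apply Rlt_le, Rinv_0_lt_compat | ]; lra.
Qed.

(** * Primitives of power series *)

Lemma Cseq_lim_unique (u : nat -> C) (l m : C) : Cseq_lim u l -> Cseq_lim u m -> l = m.
Proof.
intros Hl Hm. apply C_eq_of_le_eps. intros eps He.
destruct (Hl (eps / 2)%R ltac:(lra)) as [N HN].
destruct (Hm (eps / 2)%R ltac:(lra)) as [N' HN'].
specialize (HN (N + N')%nat ltac:(lia)). specialize (HN' (N + N')%nat ltac:(lia)).
replace (l - m) with (- (u (N + N')%nat - l) + (u (N + N')%nat - m)) by ring.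
eapply Rle_trans; [ apply Cmod_triangle | ]. rewrite Cmod_opp. lra.
Qed.

Lemma Cseq_lim_plus (u v : nat -> C) (l m : C) :
  Cseq_lim u l -> Cseq_lim v m -> Cseq_lim (fun n => u n + v n) (l + m).
Proof.
intros Hl Hm eps He.
destruct (Hl (eps / 2)%R ltac:(lra)) as [N HN].
destruct (Hm (eps / 2)%R ltac:(lra)) as [N' HN'].
exists (N + N')%nat. intros n Hn.
specialize (HN n ltac:(lia)). specialize (HN' n ltac:(lia)).
replace (u n + v n - (l + m)) with ((u n - l) + (v n - m)) by ring.
eapply Rle_lt_trans; [ apply Cmod_triangle | ]. lra.
Qed.

Lemma Cseq_lim_scal (k : C) (u : nat -> C) (l : C) :
  Cseq_lim u l -> Cseq_lim (fun n => k * u n) (k * l).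
Proof.
intros Hl eps He. assert (hk := Cmod_ge_0 k).
destruct (Hl (eps / (Cmod k + 1))%R ltac:(apply Rdiv_lt_0_compat; lra)) as [N HN].
exists N. intros n Hn. specialize (HN n Hn).
replace (k * u n - k * l) with (k * (u n - l)) by ring. rewrite Cmod_mult.
apply (Rmult_lt_compat_l (Cmod k + 1)) in HN; [ | lra ].
replace ((Cmod k + 1) * (eps / (Cmod k + 1)))%R with eps in HN by (field; lra).
assert (h := Cmod_ge_0 (u n - l)). lra.
Qed.

Lemma Cmod_Cseq_lim_le (u : nat -> C) (l : C) (B : R) :
  Cseq_lim u l -> (forall n : nat, (Cmod (u n) <= B)%R) -> (Cmod l <= B)%R.
Proof.
intros Hl HB. apply Rnot_lt_le. intros Hlt.
destruct (Hl (Cmod l - B)%R ltac:(lra)) as [N HN].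
specialize (HN N (Nat.le_refl N)). specialize (HB N).
assert (T := Cmod_triangle (u N) (- (u N - l))).
replace (u N + - (u N - l)) with l in T by ring. rewrite Cmod_opp in T. lra.
Qed.

Lemma power_series_converges (c : nat -> C) (z : C) (r M : R) :
  (Cmod z < r)%R -> (forall k : nat, (Cmod (c k) * r ^ k <= M)%R) ->
  exists l : C, Cseq_lim (power_sum c z) l.
Proof.
intros Hz HM. assert (hz := Cmod_ge_0 z).
assert (Hs : ex_series (V := C_R_CompleteNormedModule) (fun k => z ^ k * c k)).
{ apply (ex_series_le (V := C_R_CompleteNormedModule) _ (fun k => M * (Cmod z / r) ^ k)%R).
  - intros k. change (norm (V := prod_NormedModule R_AbsRing R_NormedModule R_NormedModule) (z ^ k * c k)%C <= M * (Cmod z / r) ^ k)%R.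
    rewrite <- Cmod_norm, Cmod_mult, Cmod_pow.
    assert (Hrk : (0 < r ^ k)%R) by (apply pow_lt; lra).
    unfold Rdiv. rewrite Rpow_mult_distr, pow_inv.
    specialize (HM k).
    replace (Cmod z ^ k * Cmod (c k))%R with (Cmod (c k) * r ^ k * (Cmod z ^ k * / r ^ k))%R by (field; lra).
    apply Rmult_le_compat_r; [ | assumption ].
    apply Rmult_le_pos; [ now apply pow_le | now apply Rlt_le, Rinv_0_lt_compat ].
  - apply (ex_series_scal_l (K := R_AbsRing) (V := R_NormedModule) M (fun k => (Cmod z / r) ^ k)%R), ex_series_geom.
    rewrite Rabs_pos_eq.
    + apply (Rmult_lt_reg_r r); [ lra | ]. unfold Rdiv.
      rewrite Rmult_assoc, Rinv_l by lra. lra.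
    + apply Rmult_le_pos; [ assumption | apply Rlt_le, Rinv_0_lt_compat; lra ]. }
destruct Hs as [l Hl]. exists l.
intros eps He. assert (He' : (0 < eps / 2)%R) by lra.
destruct (proj1 (filterlim_locally _ _) Hl (mkposreal _ He')) as [N HN].
exists N. intros n Hn. specialize (HN n Hn).
apply C_NormedModule_mixin_compat2 in HN.
change (Cmod (power_sum c z n - l) < sqrt 2 * (eps / 2))%R in HN.
assert (H3 := sqrt_pos 2). assert (H4 := sqrt_sqrt 2 ltac:(lra)). nra.
Qed.

Lemma RtoC_S_neq_0 (k : nat) : RtoC (INR (S k)) <> 0.
Proof. intros F. apply RtoC_inj in F. now apply (not_0_INR (S k)) in F. Qed.

(** The remainder d_n = w^n - z^n - n z^(n-1) (w - z) satisfies
    d_(n+1) = w d_n + n z^(n-1) (w - z)^2.  It is bounded here for n+1 and after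
    multiplication by rho, which keeps all exponents nonnegative. *)
Lemma Cpow_taylor_remainder (z w : C) (rho : R) (n : nat) :
  (Cmod z <= rho)%R -> (Cmod w <= rho)%R ->
  (Cmod (w ^ S n - z ^ S n - RtoC (INR (S n)) * z ^ n * (w - z)) * rho <=
   INR (S n) * INR (S n) * rho ^ n * (Cmod (w - z) * Cmod (w - z)))%R.
Proof.
intros Hz Hw.
assert (hz := Cmod_ge_0 z). assert (hw := Cmod_ge_0 w).
set (h2 := (Cmod (w - z) * Cmod (w - z))%R).
assert (Hh2 : (0 <= h2)%R) by (apply Rmult_le_pos; apply Cmod_ge_0).
induction n as [ | n IH ].
- replace (w ^ 1 - z ^ 1 - RtoC (INR 1) * z ^ 0 * (w - z)) with (RtoC 0) by (simpl; ring).
  rewrite Cmod_0. simpl. lra.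
- set (d := w ^ S n - z ^ S n - RtoC (INR (S n)) * z ^ n * (w - z)) in *.
  replace (w ^ S (S n) - z ^ S (S n) - RtoC (INR (S (S n))) * z ^ S n * (w - z))
    with (w * d + RtoC (INR (S n)) * z ^ n * ((w - z) * (w - z))).
  + set (k := INR (S n)) in *.
    assert (Hk : (0 <= k)%R) by apply pos_INR.
    replace (INR (S (S n))) with (k + 1)%R by (unfold k; now rewrite (S_INR (S n))).
    assert (T := Cmod_triangle (w * d) (RtoC k * z ^ n * ((w - z) * (w - z)))).
    rewrite !Cmod_mult, Cmod_pow, Cmod_R, (Rabs_pos_eq k) in T by assumption.
    fold h2 in T.
    assert (Hzn : (Cmod z ^ n <= rho ^ n)%R) by (apply pow_incr; lra).
    assert (Hrn : (0 <= rho ^ n)%R) by (apply pow_le; lra).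
    assert (hd := Cmod_ge_0 d).
    assert (A1 : (Cmod w * Cmod d * rho <= rho * (k * k * rho ^ n * h2))%R).
    { rewrite Rmult_assoc. apply Rmult_le_compat; try lra. apply Rmult_le_pos; lra. }
    assert (A2 : (k * Cmod z ^ n * h2 * rho <= k * rho ^ n * h2 * rho)%R).
    { apply Rmult_le_compat_r; [ lra | ]. apply Rmult_le_compat_r; [ assumption | ].
      now apply Rmult_le_compat_l. }
    assert (A3 : (0 <= (k + 1) * (rho * rho ^ n * h2))%R).
    { apply Rmult_le_pos; [ lra | ]. apply Rmult_le_pos; [ | assumption ]. apply Rmult_le_pos; lra. }
    simpl pow. nra.
  + unfold d. rewrite (S_INR (S n)), RtoC_plus. simpl Cpow. ring.
Qed.

(** The partial sums equal (1 - q^(n+1) ((n+1) (1-q) + 1)) / (1-q)^2. *)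
Lemma sum_arith_geom_le (q : R) (n : nat) :
  (0 <= q < 1)%R -> (sum_n (fun k => INR (S k) * q ^ k)%R n <= / ((1 - q) * (1 - q)))%R.
Proof.
intros Hq.
assert (H : (sum_n (fun k => INR (S k) * q ^ k)%R n * ((1 - q) * (1 - q)) =
             1 - q ^ S n * (INR (S n) * (1 - q) + 1))%R).
{ induction n as [ | n IH ].
  - rewrite sum_O. simpl. ring.
  - rewrite sum_Sn. unfold plus; simpl AbelianMonoid.sort in *; simpl (AbelianMonoid.plus _ _).
    rewrite Rmult_plus_distr_r, IH, (S_INR (S n)). simpl pow. ring. }
apply (Rmult_le_reg_r ((1 - q) * (1 - q))); [ nra | ].
rewrite H, Rinv_l by nra.
assert (h1 := pow_le q (S n) (proj1 Hq)). assert (h2 := pos_INR (S n)).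
assert (h3 : (0 <= INR (S n) * (1 - q) + 1)%R) by nra. nra.
Qed.

(** Termwise integration of a power series.  The quadratic error of each term,
    weighted by the Cauchy bounds |c_k| r^k <= M, sums to a multiple of
    |w - z|^2. *)
Lemma power_series_primitive (p : C -> C) (c : nat -> C) :
  (forall z : C, in_disk z -> is_pseries (K := C_AbsRing) (V := C_NormedModule) c z (p z)) ->
  (forall r : R, (0 < r < 1)%R -> exists M : R, forall k : nat, (Cmod (c k) * r ^ k <= M)%R) ->
  exists P : C -> C, P 0 = 0 /\ forall z : C, in_disk z -> has_Cderiv P z (p z).
Proof.
intros Hp HM.
(* The primitive is z A(z) with A = sum a_k z^k, so that both series have the
   same indexing. *)
set (a := fun k : nat => c k / RtoC (INR (S k))).
assert (Ha : forall k, (Cmod (a k) <= Cmod (c k))%R).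
{ intros k. unfold a. rewrite Cmod_div by apply RtoC_S_neq_0.
  assert (h : (1 <= INR (S k))%R) by (apply (le_INR 1); lia).
  rewrite Cmod_R, Rabs_pos_eq by lra.
  apply (Rmult_le_reg_r (INR (S k))); [ lra | ].
  unfold Rdiv. rewrite Rmult_assoc, Rinv_l by lra. assert (h0 := Cmod_ge_0 (c k)). nra. }
assert (Hex : forall z : C, exists l : C, in_disk z -> Cseq_lim (power_sum a z) l).
{ intros z. destruct (Rlt_dec (Cmod z) 1) as [ Hz | Hz ].
  - assert (hz := Cmod_ge_0 z).
    set (r := ((1 + Cmod z) / 2)%R). assert (Hr : (Cmod z < r < 1)%R) by (unfold r; lra).
    destruct (HM r ltac:(lra)) as [M HMr].
    destruct (power_series_converges a z r M) as [l Hl].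
    + lra.
    + intros k. eapply Rle_trans; [ | apply (HMr k) ].
      apply Rmult_le_compat_r; [ apply pow_le; lra | apply Ha ].
    + now exists l.
  - exists 0. intros Hin. now elim Hz. }
destruct (functional_choice _ Hex) as [A HA].
exists (fun z => z * A z). split; [ ring | ].
intros z Hz. unfold in_disk in Hz. assert (hz := Cmod_ge_0 z).
set (rho := ((1 + Cmod z) / 2)%R). set (r := ((1 + rho) / 2)%R).
assert (Hrho : (Cmod z < rho < 1)%R) by (unfold rho; lra).
assert (Hr : (rho < r < 1)%R) by (unfold r; lra).
destruct (HM r ltac:(lra)) as [M HMr].
set (q := (rho / r)%R).
assert (Hq : (0 <= q < 1)%R).
{ unfold q. split.
  - apply Rmult_le_pos; [ lra | apply Rlt_le, Rinv_0_lt_compat; lra ].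
  - apply (Rmult_lt_reg_r r); [ lra | ]. unfold Rdiv.
    rewrite Rmult_assoc, Rinv_l by lra. lra. }
assert (HM0 : (0 <= M)%R).
{ eapply Rle_trans; [ | apply (HMr O) ]. apply Rmult_le_pos; [ apply Cmod_ge_0 | simpl; lra ]. }
apply (has_Cderiv_quadratic _ z (p z) (M / rho * / ((1 - q) * (1 - q))) (rho - Cmod z)); [ lra | ].
intros w Hw.
assert (Hwr : (Cmod w <= rho)%R).
{ assert (T := Cmod_triangle (w - z) z). replace (w - z + z) with w in T by ring. lra. }
set (h2 := (Cmod (w - z) * Cmod (w - z))%R).
assert (Hh2 : (0 <= h2)%R) by (apply Rmult_le_pos; apply Cmod_ge_0).
set (E := fun n => w * power_sum a w n - z * power_sum a z n - (w - z) * power_sum c z n).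
assert (HE : Cseq_lim E (w * A w - z * A z - p z * (w - z))).
{ replace (w * A w - z * A z - p z * (w - z))
    with (w * A w + (- z) * A z + (- (w - z)) * p z) by ring.
  assert (L : Cseq_lim (fun n => w * power_sum a w n + (- z) * power_sum a z n + (- (w - z)) * power_sum c z n)
     (w * A w + (- z) * A z + (- (w - z)) * p z)).
  { apply Cseq_lim_plus; [ apply Cseq_lim_plus | ]; apply Cseq_lim_scal.
    - apply HA. unfold in_disk. lra.
    - now apply HA.
    - apply is_pseries_C_iff. now apply Hp. }
  intros eps He. destruct (L eps He) as [N HN]. exists N. intros n Hn. specialize (HN n Hn).
  unfold E.
  replace (w * power_sum a w n - z * power_sum a z n - (w - z) * power_sum c z n)
    with (w * power_sum a w n + (- z) * power_sum a z n + (- (w - z)) * power_sum c z n) by ring.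
  exact HN. }
apply (Cmod_Cseq_lim_le E); [ exact HE | ]. intros n.
assert (Hterm : forall k, (Cmod (w * (w ^ k * a k) - z * (z ^ k * a k) - (w - z) * (z ^ k * c k))
   <= M / rho * h2 * (INR (S k) * q ^ k))%R).
{ intros k. assert (HS := RtoC_S_neq_0 k).
  replace (w * (w ^ k * a k) - z * (z ^ k * a k) - (w - z) * (z ^ k * c k))
    with (a k * (w ^ S k - z ^ S k - RtoC (INR (S k)) * z ^ k * (w - z))).
  2: { unfold a. simpl Cpow. field. assumption. }
  rewrite Cmod_mult. unfold a at 1. rewrite Cmod_div by assumption.
  assert (HSk : (0 < INR (S k))%R) by (apply lt_0_INR; lia).
  rewrite Cmod_R, (Rabs_pos_eq (INR (S k))) by lra.
  assert (R1 := Cpow_taylor_remainder z w rho k ltac:(lra) Hwr). fold h2 in R1.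
  set (D := Cmod (w ^ S k - z ^ S k - RtoC (INR (S k)) * z ^ k * (w - z))) in *.
  set (s := INR (S k)) in *.
  assert (Hrk : (0 < r ^ k)%R) by (apply pow_lt; lra).
  assert (Hpk : (0 < rho ^ k)%R) by (apply pow_lt; lra).
  unfold q, Rdiv. rewrite Rpow_mult_distr, pow_inv.
  apply (Rmult_le_reg_r (rho * s)); [ apply Rmult_lt_0_compat; lra | ].
  replace (Cmod (c k) * / s * D * (rho * s))%R with (Cmod (c k) * (D * rho))%R by (field; lra).
  replace (M * / rho * h2 * (s * (rho ^ k * / r ^ k)) * (rho * s))%R
    with (M * / r ^ k * (s * s * rho ^ k * h2))%R by (field; lra).
  apply Rmult_le_compat; [ apply Cmod_ge_0 | | | exact R1 ].
  - apply Rmult_le_pos; [ apply Cmod_ge_0 | lra ].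
  - apply (Rmult_le_reg_r (r ^ k)); [ assumption | ].
    rewrite Rmult_assoc, Rinv_l, Rmult_1_r by lra. apply HMr. }
assert (Hsum : (Cmod (E n) <= M / rho * h2 * sum_n (fun k => INR (S k) * q ^ k)%R n)%R).
{ unfold E. induction n as [ | n IH ].
  - rewrite !power_sum_O, sum_O. specialize (Hterm 0%nat). simpl Cpow in Hterm.
    rewrite !Cmult_1_l in Hterm. exact Hterm.
  - rewrite !power_sum_S, sum_Sn.
    replace (w * (power_sum a w n + w ^ S n * a (S n)) - z * (power_sum a z n + z ^ S n * a (S n)) -
             (w - z) * (power_sum c z n + z ^ S n * c (S n)))
      with ((w * power_sum a w n - z * power_sum a z n - (w - z) * power_sum c z n) +
            (w * (w ^ S n * a (S n)) - z * (z ^ S n * a (S n)) - (w - z) * (z ^ S n * c (S n)))) by ring.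
    eapply Rle_trans; [ apply Cmod_triangle | ].
    unfold plus; simpl (AbelianMonoid.plus _ _). rewrite Rmult_plus_distr_l.
    apply Rplus_le_compat; [ exact IH | apply Hterm ]. }
eapply Rle_trans; [ exact Hsum | ].
replace (M / rho * / ((1 - q) * (1 - q)) * h2)%R with (M / rho * h2 * / ((1 - q) * (1 - q)))%R by ring.
apply Rmult_le_compat_l; [ | now apply sum_arith_geom_le ].
apply Rmult_le_pos; [ | assumption ].
apply Rmult_le_pos; [ assumption | apply Rlt_le, Rinv_0_lt_compat; lra ].
Qed.

(** * Starlike quotients *)

Lemma in_disk_0 : in_disk 0.
Proof. unfold in_disk. rewrite Cmod_0. lra. Qed.

(** The solution g = z exp(P) of z g' / g = psi, where P is a primitive of
    (psi - 1) / z.  Both this quotient and exp(P) are expanded in Taylor series: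
    the first to construct P, the second to exhibit the series of g. *)
Lemma extremal_starlike_function (psi : C -> C) :
  analytic_in_disk psi -> psi 0 = 1 ->
  exists g : C -> C, class_Sstar psi g /\
    forall z : C, in_disk z -> starlike_quotient g z = psi z.
Proof.
intros Hpsi H1.
destruct (analytic_in_disk_has_Cderiv psi Hpsi 0 in_disk_0) as [l [p [Hpc [_ Hslope]]]].
assert (Hzp : forall z : C, psi z = 1 + z * p z).
{ intros z. specialize (Hslope z). rewrite H1 in Hslope.
  replace (psi z) with (psi z - 1 + 1) by ring. rewrite Hslope. ring. }
assert (Hd : forall z : C, in_disk z -> z <> 0 -> exists m : C, has_Cderiv p z m).
{ intros z Hz Hz0. destruct (analytic_in_disk_has_Cderiv psi Hpsi z Hz) as [m Hm]. eexists.
  apply (has_Cderiv_ext_near (fun v => (psi v - 1) / v) p z _ (Cmod z)).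
  - now apply Cmod_gt_0.
  - intros w Hw. rewrite Hzp. field. intros ->.
    replace (0 - z) with (- z) in Hw by ring. rewrite Cmod_opp in Hw. lra.
  - apply has_Cderiv_mult; [ apply has_Cderiv_minus; [ exact Hm | apply has_Cderiv_const ] | ].
    apply has_Cderiv_inv; [ apply has_Cderiv_id | assumption ]. }
assert (Hc : continuous_in_disk p).
{ intros z Hz. destruct (Ceq_dec z 0) as [ -> | n ]; [ assumption | ].
  destruct (Hd z Hz n) as [m Hm]. now apply has_Cderiv_continuous in Hm. }
destruct (taylor_in_disk p Hc Hd) as [c [Hps HM]].
destruct (power_series_primitive p c Hps HM) as [P [HP0 HP]].
set (E := fun z => Cexp (P z)).
assert (HE : forall z : C, in_disk z -> has_Cderiv E z (E z * p z)).
{ intros z Hz. apply (has_Cderiv_comp Cexp P); [ apply has_Cderiv_Cexp | now apply HP ]. }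
destruct (taylor_in_disk E) as [e [He _]].
{ intros z Hz. exact (has_Cderiv_continuous _ _ _ (HE z Hz)). }
{ intros z Hz _. eexists. now apply HE. }
assert (He0 : e 0%nat = 1).
{ apply (Cseq_lim_unique (power_sum e 0)).
  - intros eps Heps. exists 0%nat. intros n _.
    replace (power_sum e 0 n) with (e 0%nat).
    + replace (e 0%nat - e 0%nat) with (RtoC 0) by ring. now rewrite Cmod_0.
    + symmetry. induction n as [ | n IH ]; [ apply power_sum_O | ].
      rewrite power_sum_S, IH. simpl Cpow. ring.
  - replace (RtoC 1) with (E 0) by (unfold E; rewrite HP0; apply Cexp_0).
    apply is_pseries_C_iff, He, in_disk_0. }
set (g := fun z => z * E z).
assert (Hg : forall z : C, in_disk z -> has_Cderiv g z (1 * E z + z * (E z * p z))).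
{ intros z Hz. apply has_Cderiv_mult; [ apply has_Cderiv_id | now apply HE ]. }
assert (Hq : forall z : C, in_disk z -> starlike_quotient g z = psi z).
{ intros z Hz. unfold starlike_quotient. destruct (Ceq_dec z 0) as [ -> | n ].
  - now rewrite H1.
  - rewrite (is_C_derive_unique g z (1 * E z + z * (E z * p z))).
    + rewrite Hzp. unfold g. assert (HEz : E z <> 0) by apply Cexp_neq_0.
      field. now split.
    + apply is_derive_has_Cderiv. now apply Hg. }
exists g. split; [ split | exact Hq ].
- split.
  + intros z Hz. eexists. apply is_derive_has_Cderiv. now apply Hg.
  + exists (PS_incr_1 (V := C_NormedModule) e). split; [ reflexivity | split; [ exact He0 | ] ].
    intros z Hz. apply (is_pseries_incr_1 (K := C_AbsRing) (V := C_NormedModule)). now apply He.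
- exists (fun z => z). split; [ | split; [ reflexivity | split ] ].
  + intros z _. exists (RtoC 1). apply is_derive_has_Cderiv, has_Cderiv_id.
  + auto.
  + exact Hq.
Qed.

(** Schwarz's lemma places w z in the closed disk of radius |z|, and the minimum
    principle carries the bound from its boundary circle to w z. *)
Lemma Re_quotient_lower_bound (psi g : C -> C) (z : C) :
  analytic_in_disk psi -> circle_min_at_neg psi ->
  subordinate (starlike_quotient g) psi -> z <> 0 -> in_disk z ->
  (Re (psi (RtoC (- Cmod z)%R)) <= Re (starlike_quotient g z))%R.
Proof.
intros Hpsi Hmin [w [Hw [Hw0 [Hin Hsub]]]] Hz0 Hz.
assert (Hm0 : (0 < Cmod z)%R) by now apply Cmod_gt_0.
destruct (Hmin (Cmod z) (conj Hm0 Hz)) as [m [[_ Hle] Hm]].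
rewrite <- Hm, Hsub by assumption. simpl.
apply (minimum_principle_Re psi (w z) (Cmod z)); try assumption.
now apply schwarz_lemma.
Qed.

(** At a zero of g other than 0 the quotient would be 0, whose real part is not
    positive. *)
Lemma starlike_nonvanishing (psi g : C -> C) (z : C) :
  class_P psi -> subordinate (starlike_quotient g) psi -> z <> 0 -> in_disk z -> g z <> 0.
Proof.
intros [_ [_ Hpos]] [w [_ [_ [Hin Hsub]]]] Hz0 Hz Hg.
assert (H := Hpos (w z) (Hin z Hz)). rewrite <- (Hsub z Hz) in H.
unfold starlike_quotient in H. destruct (Ceq_dec z 0) as [ | _ ]; [ contradiction | ].
rewrite Hg in H. unfold Cdiv in H.
replace (/ 0) with (RtoC 0) in H by (apply injective_projections; simpl; unfold Rdiv; ring).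
rewrite Cmult_0_r in H. simpl in H. lra.
Qed.

Lemma starlike_quotient_product (g h : C -> C) (z : C) :
  ex_derive (K := C_AbsRing) (V := C_NormedModule) g z ->
  ex_derive (K := C_AbsRing) (V := C_NormedModule) h z ->
  z <> 0 -> g z <> 0 -> h z <> 0 ->
  starlike_quotient (product_over_z g h) z = starlike_quotient g z + starlike_quotient h z - 1.
Proof.
intros [l Hl] [m Hm] Hz Hg Hh.
unfold starlike_quotient. destruct (Ceq_dec z 0) as [ | _ ]; [ contradiction | ].
rewrite (is_C_derive_unique g z l Hl), (is_C_derive_unique h z m Hm).
rewrite (is_C_derive_unique (product_over_z g h) z
  ((l * h z + g z * m) * / z + g z * h z * (- / (z * z) * 1))).
- unfold product_over_z. field. repeat split; assumption.
- apply is_derive_has_Cderiv. unfold product_over_z.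
  apply (has_Cderiv_mult (fun z => g z * h z) (fun z => / z)).
  + apply has_Cderiv_mult; now apply is_derive_has_Cderiv.
  + apply (has_Cderiv_inv (fun z => z)); [ apply has_Cderiv_id | assumption ].
Qed.

(** The function psi1(-s) + psi2(-s) - 1 - gamma is positive at s = 0, where it
    equals 1 - gamma, so a nonpositive value at r would produce a root in (0, r].
    The values of psi1 and psi2 on the negative axis being real, a zero of the
    real part solves the complex equation. *)
Lemma sum_gt_before_least_root (psi1 psi2 : C -> C) (gamma r0 r : R) :
  class_P psi1 -> class_P psi2 -> circle_min_at_neg psi1 -> circle_min_at_neg psi2 ->
  (gamma < 1)%R -> is_least_root psi1 psi2 gamma r0 -> (0 < r < r0)%R ->
  (1 + gamma < Re (psi1 (RtoC (- r)%R)) + Re (psi2 (RtoC (- r)%R)))%R.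
Proof.
intros [A1 [N1 _]] [A2 [N2 _]] M1 M2 Hgam [[Hr0 _] Hleast] Hr.
apply Rnot_le_lt. intros Hneg.
set (u := fun s : R => (Re (psi1 (RtoC (- s)%R)) + Re (psi2 (RtoC (- s)%R)) - 1 - gamma)%R).
assert (Hcu : forall (psi : C -> C) (s : R), analytic_in_disk psi -> (0 <= s <= r)%R ->
  continuous (fun s : R => Re (psi (RtoC (- s)%R))) s).
{ intros psi s Hpsi Hs. apply (continuous_Re (fun s : R => psi (RtoC (- s)%R))).
  apply (continuous_comp (fun s : R => RtoC (- s)%R) psi).
  - apply continuous_C_pair; [ | apply continuous_const ].
    apply (continuous_opp (fun s : R => s)), continuous_id.
  - apply analytic_in_disk_continuous; [ assumption | ].
    unfold in_disk. rewrite Cmod_R, Rabs_Ropp, Rabs_pos_eq; lra. }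
assert (Hc : forall s : R, (0 <= s <= r)%R -> continuity_pt (fun s => - u s)%R s).
{ intros s Hs. apply continuity_pt_filterlim. apply (continuous_opp u).
  apply (continuous_minus (fun s => Re (psi1 (RtoC (- s)%R)) + Re (psi2 (RtoC (- s)%R)) - 1)%R (fun _ => gamma)).
  - apply (continuous_minus (fun s => Re (psi1 (RtoC (- s)%R)) + Re (psi2 (RtoC (- s)%R)))%R (fun _ => 1%R)).
    + apply (continuous_plus (fun s => Re (psi1 (RtoC (- s)%R))) (fun s => Re (psi2 (RtoC (- s)%R))));
        now apply Hcu.
    + apply continuous_const.
  - apply continuous_const. }
assert (Hu0 : (0 < u 0)%R).
{ unfold u. rewrite Ropp_0, N1, N2. simpl. lra. }
assert (Hroot : exists s : R, (0 <= s <= r)%R /\ u s = 0%R).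
{ destruct (Req_dec (u r) 0) as [ Hz | Hnz ].
  - exists r. split; [ lra | exact Hz ].
  - destruct (IVT_interv (fun s => - u s)%R 0 r Hc) as [s [Hs Hus]].
    + lra.
    + lra.
    + unfold u in *. lra.
    + exists s. split; [ exact Hs | lra ]. }
destruct Hroot as [s [Hs Hus]].
assert (Hs0 : (0 < s)%R).
{ destruct (proj1 Hs) as [ H | <- ]; [ exact H | lra ]. }
assert (Hs1 : (0 < s < 1)%R) by lra.
destruct (M1 s Hs1) as [m1 [_ E1]]. destruct (M2 s Hs1) as [m2 [_ E2]].
assert (Hle : (r0 <= s)%R).
{ apply Hleast. split; [ exact Hs1 | ]. unfold u in Hus. rewrite <- E1, <- E2 in *.
  simpl in Hus. apply injective_projections; simpl; lra. }
lra.
Qed.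

Theorem theorem3p3 (psi1 psi2 : C -> C) (gamma r_gamma : R)
  (hpsi1 : class_P psi1) (hpsi2 : class_P psi2)
  (hmin1 : circle_min_at_neg psi1) (hmin2 : circle_min_at_neg psi2)
  (hgamma : (0 <= gamma < 1)%R)
  (hroot : is_least_root psi1 psi2 gamma r_gamma) :
  (forall g h : C -> C, class_Sstar psi1 g -> class_Sstar psi2 h ->
     starlike_of_order_in gamma r_gamma (product_over_z g h)) /\
  (forall rho : R, (r_gamma < rho <= 1)%R ->
     ~ (forall g h : C -> C, class_Sstar psi1 g -> class_Sstar psi2 h ->
          starlike_of_order_in gamma rho (product_over_z g h))).
Proof.
assert (Hr : (0 < r_gamma < 1)%R) by apply hroot.
split.
- intros g h [[Ag _] Sg] [[Ah _] Sh] z Hz.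
  destruct (Ceq_dec z 0) as [ -> | n ].
  + unfold starlike_quotient. destruct (Ceq_dec 0 0) as [ _ | n ]; [ simpl; lra | now elim n ].
  + assert (Hzd : in_disk z) by (unfold in_disk; lra).
    assert (Hzm : (0 < Cmod z)%R) by now apply Cmod_gt_0.
    rewrite starlike_quotient_product; auto.
    * assert (B1 := Re_quotient_lower_bound psi1 g z (proj1 hpsi1) hmin1 Sg n Hzd).
      assert (B2 := Re_quotient_lower_bound psi2 h z (proj1 hpsi2) hmin2 Sh n Hzd).
      assert (B := sum_gt_before_least_root psi1 psi2 gamma r_gamma (Cmod z)
        hpsi1 hpsi2 hmin1 hmin2 (proj2 hgamma) hroot (conj Hzm Hz)).
      unfold Re in *. simpl. lra.
    * now apply (starlike_nonvanishing psi1).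
    * now apply (starlike_nonvanishing psi2).
- intros rho Hrho Hall.
  destruct (extremal_starlike_function psi1) as [g [Sg Qg]]; [ apply hpsi1 | apply hpsi1 | ].
  destruct (extremal_starlike_function psi2) as [h [Sh Qh]]; [ apply hpsi2 | apply hpsi2 | ].
  set (z := RtoC (- r_gamma)%R).
  assert (Hzm : Cmod z = r_gamma) by (unfold z; rewrite Cmod_R, Rabs_Ropp, Rabs_pos_eq; lra).
  assert (Hzd : in_disk z) by (unfold in_disk; lra).
  assert (Hz0 : z <> 0) by (apply Cmod_gt_0; lra).
  specialize (Hall g h Sg Sh z ltac:(lra)).
  destruct Sg as [[Ag _] Sg]. destruct Sh as [[Ah _] Sh].
  rewrite starlike_quotient_product in Hall; auto.
  + rewrite Qg, Qh in Hall by assumption.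
    destruct hroot as [[_ Hroot] _]. fold z in Hroot.
    replace (psi1 z + psi2 z - 1) with (psi1 z + psi2 z - 1 - RtoC gamma + RtoC gamma) in Hall by ring.
    rewrite Hroot in Hall. simpl in Hall. lra.
  + now apply (starlike_nonvanishing psi1).
  + now apply (starlike_nonvanishing psi2).
Qed.
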